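(* Let $p(x,y,t)$ be the transition density at time $t>0$ of the Brownian swapping process with swap rate $s>0$ started at $(x_0,y_0)$ (described in the context), and let $\bar\mu=(\mu_1+\mu_2)/2$. Consider the diffusive scaling $$\xi=\frac{x-(\frac{x_0+y_0}{2}+\bar\mu t)}{\sqrt{(\sigma_1^2+\sigma_2^2)t/2}},\qquad\eta=\frac{y-(\frac{x_0+y_0}{2}+\bar\mu t)}{\sqrt{(\sigma_1^2+\sigma_2^2)t/2}}.$$ If one first lets $s\to\infty$ with $t$ fixed and afterwards lets $t\to\infty$, then the density of $(\xi,\eta)$ converges to the standard isotropic planar normal density: $$p(x,y,t)\,\mathrm{d}x\,\mathrm{d}y\;\longrightarrow\;\frac{1}{2\pi}e^{-(\xi^2+\eta^2)/2}\,\mathrm{d}\xi\,\mathrm{d}\eta .$$ That is, for each fixed $t>0$ the density of $(\xi,\eta)$ under $p(\cdot,\cdot,t)$ has an $L^1(\mathbb{R}^2)$-limit $g_t$ as $s\to\infty$, and $g_t\to\frac{1}{2\pi}e^{-(\xi^2+\eta^2)/2}$ in $L^1(\mathbb{R}^2)$ as $t\to\infty$.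
   Context: The Brownian swapping process with parameters $\mu_1,\mu_2\in\mathbb{R}$, $\sigma_1,\sigma_2>0$, $s>0$ is the càdlàg Markov process $(X,Y)$ on $\mathbb{R}^2$ with $\mathrm{d}X_t=\mu_1\mathrm{d}t+\sigma_1\mathrm{d}W^1_t+(Y_{t-}-X_{t-})\mathrm{d}\mathcal{N}_t$, $\mathrm{d}Y_t=\mu_2\mathrm{d}t+\sigma_2\mathrm{d}W^2_t+(X_{t-}-Y_{t-})\mathrm{d}\mathcal{N}_t$, $(X_0,Y_0)=(x_0,y_0)$, where $W^1,W^2$ are independent standard one-dimensional Brownian motions and $\mathcal{N}$ is an independent Poisson process of rate $s$ (at each jump of $\mathcal{N}$ the two coordinates are exchanged). Its generator is $\mathcal{L}f(x,y)=\mu_1\partial_xf+\mu_2\partial_yf+\frac{\sigma_1^2}{2}\partial_x^2f+\frac{\sigma_2^2}{2}\partial_y^2f+s[f(y,x)-f(x,y)]$. *)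

(* Defs.v *)
From HB Require Import structures.
From mathcomp Require Import all_boot all_order all_algebra.
From mathcomp Require Import all_classical all_reals all_analysis.
Set Implicit Arguments.
Unset Strict Implicit.
Unset Printing Implicit Defensive.
Import Order.TTheory GRing.Theory Num.Theory.
Import numFieldNormedType.Exports.
Local Open Scope classical_set_scope.
Local Open Scope ring_scope.

(* A process is a family Z : R -> {RV P >-> R}; only times t >= 0 matter, and
   its value at negative times is junk which no definition below looks at. *)

Definition sigma_of_process (R : realType) (d : measure_display)
    (T : measurableType d) (P : probability T R) (Z : R -> {RV P >-> R})
    : set (set T) :=
  <<s \bigcup_(t in `[0, +oo[) preimage_set_system setT (Z t) measurable >>.

(* As each of A, B, C may be the full space, the triple product rule also gives
   the pairwise ones. *)
Definition independent3 (R : realType) (d : measure_display)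
    (T : measurableType d) (P : probability T R) (F G H : set (set T)) : Prop :=
  forall A B C : set T, F A -> G B -> H C ->
    P (A `&` B `&` C) = (P A * P B * P C)%E.

Definition increment (R : realType) (d : measure_display)
    (T : measurableType d) (P : probability T R) (Z : R -> {RV P >-> R})
    (u t : R) : T -> R :=
  fun w => Z t w - Z u w.

Definition independent_increments (R : realType) (d : measure_display)
    (T : measurableType d) (P : probability T R) (Z : R -> {RV P >-> R})
    : Prop :=
  forall (n : nat) (t : nat -> R) (B : nat -> set R),
    0 <= t 0%N -> {homo t : i j / (i <= j)%N >-> i <= j} ->
    (forall i, measurable (B i)) ->
    P (\bigcap_(i < n) (increment Z (t i) (t i.+1) @^-1` B i)) =
    (\prod_(i < n) P (increment Z (t i) (t i.+1) @^-1` B i))%E.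

Record brownian_motion (R : realType) (d : measure_display)
    (T : measurableType d) (P : probability T R) (W : R -> {RV P >-> R})
    : Prop := BrownianMotion {
  bm_init : {ae P, forall w, W 0 w = 0} ;
  bm_indep : independent_increments W ;
  bm_law : forall u t : R, 0 <= u -> u < t ->
    forall B : set R, measurable B ->
      P (increment W u t @^-1` B) = normal_prob 0 (Num.sqrt (t - u)) B ;
  bm_cont : {ae P, forall w,
    {within `[0, +oo[%classic, continuous (fun t : R => W t w)}} }.

Definition left_limit (R : realType) (f : R -> R) (t : R) : R :=
  lim (f v @[v --> t^'-]).

Definition cadlag (R : realType) (f : R -> R) : Prop :=
  (forall t, 0 <= t -> f v @[v --> t^'+] --> f t) /\
  (forall t, 0 < t -> cvg (f v @[v --> t^'-])).

Record poisson_process (R : realType) (d : measure_display)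
    (T : measurableType d) (P : probability T R) (rate : R)
    (N : R -> {RV P >-> R}) : Prop := PoissonProcess {
  pp_init : {ae P, forall w, N 0 w = 0} ;
  pp_indep : independent_increments N ;
  pp_law : forall u t : R, 0 <= u -> u < t -> forall k : nat,
    P (increment N u t @^-1` [set k%:R]) =
    (poisson_pmf (rate * (t - u)) k)%:E ;
  pp_count : {ae P, forall w, forall t : R, 0 <= t ->
    exists k : nat, N t w = k%:R} ;
  pp_mono : {ae P, forall w, forall u t : R, 0 <= u -> u <= t ->
    N u w <= N t w} ;
  pp_cadlag : {ae P, forall w, cadlag (fun t : R => N t w)} }.

(* The Stieltjes integral \int_(]0, t]) h_(u-) dN_u against a path N of a
   counting process. Such a path is constant except for finitely many jumps in
   ]0, t], so the finitely supported sum is the genuine one. *)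
Definition jump_integral (R : realType) (h N : R -> R) (t : R) : R :=
  \sum_(u \in `]0, t]%classic) left_limit h u * (N u - left_limit N u).

Record brownian_swapping_process (R : realType) (d : measure_display)
    (T : measurableType d) (P : probability T R)
    (mu1 mu2 sigma1 sigma2 s x0 y0 : R)
    (X Y W1 W2 N : R -> {RV P >-> R}) : Prop := BrownianSwappingProcess {
  bsp_W1 : brownian_motion W1 ;
  bsp_W2 : brownian_motion W2 ;
  bsp_N : poisson_process s N ;
  bsp_indep : independent3 P (sigma_of_process W1) (sigma_of_process W2)
    (sigma_of_process N) ;
  bsp_cadlagX : {ae P, forall w, cadlag (fun t : R => X t w)} ;
  bsp_cadlagY : {ae P, forall w, cadlag (fun t : R => Y t w)} ;
  bsp_X : {ae P, forall w, forall t : R, 0 <= t ->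
    X t w = x0 + mu1 * t + sigma1 * W1 t w
            + jump_integral (fun u => Y u w - X u w) (fun u => N u w) t} ;
  bsp_Y : {ae P, forall w, forall t : R, 0 <= t ->
    Y t w = y0 + mu2 * t + sigma2 * W2 t w
            + jump_integral (fun u => X u w - Y u w) (fun u => N u w) t} }.

Definition is_density (R : realType) (nu : set (R * R) -> \bar R)
    (f : R * R -> R) : Prop :=
  [/\ measurable_fun setT f, (forall z, 0 <= f z) &
      forall B : set (R * R), measurable B ->
        nu B = (\int[@lebesgue_measure R \x @lebesgue_measure R]_(z in B)
                  (f z)%:E)%E].

Definition is_transition_density (R : realType)
    (mu1 mu2 sigma1 sigma2 s x0 y0 : R) (p : R -> R * R -> R) : Prop :=
  exists (d : measure_display) (T : measurableType d) (P : probability T R)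
         (X Y W1 W2 N : R -> {RV P >-> R}),
    brownian_swapping_process mu1 mu2 sigma1 sigma2 s x0 y0 X Y W1 W2 N /\
    forall t, 0 < t ->
      is_density (fun B => P ((fun w => (X t w, Y t w)) @^-1` B)) (p t).

Definition diffusive_scaling (R : realType)
    (mu1 mu2 sigma1 sigma2 x0 y0 t : R) (z : R * R) : R * R :=
  let m := (x0 + y0) / 2 + (mu1 + mu2) / 2 * t in
  let c := Num.sqrt ((sigma1 ^+ 2 + sigma2 ^+ 2) * t / 2) in
  ((z.1 - m) / c, (z.2 - m) / c).

Definition law_under (R : realType) (f : R * R -> R) (h : R * R -> R * R)
    : set (R * R) -> \bar R :=
  fun B => (\int[@lebesgue_measure R \x @lebesgue_measure R]_(z in h @^-1` B)
              (f z)%:E)%E.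

Definition L1_dist (R : realType) (f g : R * R -> R) : \bar R :=
  (\int[@lebesgue_measure R \x @lebesgue_measure R]_z
     (`|f z - g z|%R)%:E)%E.

Definition planar_normal_pdf (R : realType) (z : R * R) : R :=
  (2 * pi)^-1 * expR (- (z.1 ^+ 2 + z.2 ^+ 2) / 2).

(* Main.v *)
From HB Require Import structures.
Require Import Defs.
From mathcomp Require Import all_boot all_order all_algebra.
From mathcomp Require Import all_classical all_reals all_analysis.
From mathcomp Require Import measurable_realfun ring lra.
Set Implicit Arguments.
Unset Strict Implicit.
Unset Printing Implicit Defensive.
Import Order.TTheory GRing.Theory Num.Theory.
Import numFieldNormedType.Exports.
Local Open Scope classical_set_scope.
Local Open Scope ring_scope.

(** The process is best described by two particles which keep their identity
    through the swaps. As a swap exchanges the coordinates, (X, Y) is (U, V) or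
    (V, U) according to the parity of the number of swaps, where U and V are
    continuous: U moves with the coefficients (mu1, sigma1) while that number is
    even and with (mu2, sigma2) while it is odd, and V does the opposite, so that
    they never use the same Brownian motion at the same time. Given the swap
    times, U and V are therefore independent normal variables, and their
    parameters depend on the swap times only through the difference A between the
    times spent in the two states. In the diffusive scale, with c the spread at
    time t, the means are a + be A and - (a + be A) with a = (x0 - y0) / (2 c), and
    the variances are 1 + ka A and 1 - ka A. As E[A^2] <= 2 t / s, and as the
    parity of the number of swaps tends to a fair coin, the limit for s -> oo is
    the even mixture [mixed_pdf a] of the two orders of N(a, 1) and N(- a, 1). When
    t grows, a tends to 0, and Scheffe's lemma gives the standard planar density.

    Conditioning on the swap times is avoided by cutting [0, t] into 2^k equal
    steps and recording only in which steps a swap occurs, which leaves finitely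
    many patterns: [discretized_law] is the elementary total probability formula,
    and [jump_average_bound] averages it over the patterns with an error that does
    not depend on k. Almost surely, every step eventually contains at most one
    swap, by the Borel-Cantelli lemma; then only the steps with a swap contribute
    to the discretization error, and the discretized positions converge to (X, Y)
    ([mesh_cvg]).

    Almost sure convergence transfers the bound to open sets ([open_liminf]), outer
    regularity of the limit law to Borel sets ([scaled_position_law]), and a bound
    on all Borel sets is a bound on the L1 distance of densities
    ([le_integral_dist]). *)

(** * Total variation and densities *)

Section densities.
Context d (T : measurableType d) (R : realType).
Variable mu : {measure set T -> \bar R}.
Local Open Scope ereal_scope.

Lemma integrable_density (f : T -> R) :
  measurable_fun setT f -> (forall z, (0 <= f z)%R) ->
  \int[mu]_z (f z)%:E < +oo -> mu.-integrable setT (EFin \o f).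
Proof.
move=> mf f0 fint; apply/integrableP; split; first exact/measurable_EFinP.
under eq_integral => z _ do rewrite /= ger0_norm ?f0//.
exact: fint.
Qed.

(** Two densities of mass 1 exceed each other by the same amount, so a one-sided
    bound on all events, used on the event where f exceeds g, bounds the distance. *)
Lemma le_integral_dist (f g : T -> R) (e : R) :
  measurable_fun setT f -> measurable_fun setT g ->
  (forall z, (0 <= f z)%R) -> (forall z, (0 <= g z)%R) ->
  \int[mu]_z (f z)%:E = 1 -> \int[mu]_z (g z)%:E = 1 ->
  (forall B, measurable B ->
     \int[mu]_(z in B) (f z)%:E <= \int[mu]_(z in B) (g z)%:E + e%:E) ->
  \int[mu]_z (`|f z - g z|%R)%:E <= (2 * e)%:E.
Proof.
move=> mf mg f0 g0 f1 g1 fg.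
have If : mu.-integrable setT (EFin \o f).
  by apply: integrable_density => //; rewrite f1 ltry.
have Ig : mu.-integrable setT (EFin \o g).
  by apply: integrable_density => //; rewrite g1 ltry.
pose B := [set z | (g z < f z)%R].
have mB : measurable B.
  rewrite -[B]setTI; exact: (measurable_fun_ltr mg mf measurableT (Y := [set true])).
have mBC : measurable (~` B) by exact: measurableC.
have sub (h : T -> R) C : measurable_fun setT h -> (forall z, (0 <= h z)%R) ->
    \int[mu]_z (h z)%:E = 1 -> measurable C ->
    exists2 r : R, \int[mu]_(z in C) (h z)%:E = r%:E &
      \int[mu]_(z in ~` C) (h z)%:E = (1 - r)%:E.
  move=> mh h0 h1 mC.
  have := @ge0_integral_setU _ _ _ mu C (~` C) mC (measurableC mC) (EFin \o h).
  rewrite setUv h1.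
  move=> /(_ _ _ _)/esym H.
  have {}H : \int[mu]_(z in C) (h z)%:E + \int[mu]_(z in ~` C) (h z)%:E = 1.
    apply: H => //; first exact/measurable_EFinP.
      by move=> z _; rewrite lee_fin.
    by rewrite disj_set2E setICr.
  have p1 : 0 <= \int[mu]_(z in C) (h z)%:E.
    by apply: integral_ge0 => z _; rewrite lee_fin.
  have p2 : 0 <= \int[mu]_(z in ~` C) (h z)%:E.
    by apply: integral_ge0 => z _; rewrite lee_fin.
  case: (\int[mu]_(z in C) (h z)%:E) H p1 => [r| |]//; last first.
    by case: (\int[mu]_(z in ~` C) (h z)%:E) p2.
  case: (\int[mu]_(z in ~` C) (h z)%:E) p2 => [r'| |]// _ [H] _.
  by exists r => //; congr (_%:E); rewrite -H addrC addrK.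
have [rf fB fBC] := sub f B mf f0 f1 mB.
have [rg gB gBC] := sub g B mg g0 g1 mB.
have := fg B mB; rewrite fB gB -EFinD lee_fin => le.
rewrite -(setUv B) ge0_integral_setU//; last 2 first.
- rewrite setUv; apply/measurable_EFinP; apply: measurableT_comp => //.
  exact: measurable_funB.
- by rewrite disj_set2E setICr.
have -> : \int[mu]_(z in B) (`|f z - g z|%R)%:E = (rf - rg)%:E.
  rewrite EFinB -fB -gB -integralB//; last 2 first.
    exact: integrableS If.
    exact: integrableS Ig.
  by apply: eq_integral => z; rewrite inE /B/= => /ltW h; rewrite ger0_norm ?subr_ge0.
have -> : \int[mu]_(z in ~` B) (`|f z - g z|%R)%:E = (1 - rg - (1 - rf))%:E.
  rewrite EFinB -fBC -gBC -integralB//; last 2 first.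
    exact: integrableS Ig.
    exact: integrableS If.
  apply: eq_integral => z; rewrite inE /B/= => /negP; rewrite -leNgt => h.
  by rewrite distrC ger0_norm ?subr_ge0.
rewrite -EFinD lee_fin; lra.
Qed.

Lemma integral_le_dist (f g : T -> R) (B : set T) :
  measurable_fun setT f -> measurable_fun setT g ->
  (forall z, (0 <= f z)%R) -> (forall z, (0 <= g z)%R) -> measurable B ->
  \int[mu]_(z in B) (f z)%:E <=
  \int[mu]_(z in B) (g z)%:E + \int[mu]_z (`|f z - g z|%R)%:E.
Proof.
move=> mf mg f0 g0 mB.
have md : measurable_fun setT (fun z => `|f z - g z|%R).
  by apply: measurableT_comp => //; exact: measurable_funB.
apply: (@le_trans _ _ (\int[mu]_(z in B) (g z)%:E + \int[mu]_(z in B) (`|f z - g z|%R)%:E)).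
  rewrite -ge0_integralD//; last 3 first.
  - by move=> z _; rewrite lee_fin.
  - by apply/measurable_EFinP; exact: measurable_funS mg.
  - by apply/measurable_EFinP; exact: measurable_funS md.
  apply: ge0_le_integral => //.
  - by move=> z _; rewrite lee_fin.
  - by apply/measurable_EFinP; exact: measurable_funS mf.
  - by apply/measurable_EFinP; apply: measurable_funD;
      exact: measurable_funS mg || exact: measurable_funS md.
  - by move=> z _; rewrite -EFinD lee_fin -lerBlDl ler_norm.
apply: leeD2l; apply: ge0_subset_integral => //; exact/measurable_EFinP.
Qed.

(** Since both masses are 1, the distance is twice the integral of the positive
    part of f - f_n, which f itself dominates. *)
Lemma scheffe (f_ : nat -> T -> R) (f : T -> R) :
  (forall n, measurable_fun setT (f_ n)) -> measurable_fun setT f ->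
  (forall n z, (0 <= f_ n z)%R) -> (forall z, (0 <= f z)%R) ->
  (forall n, \int[mu]_z (f_ n z)%:E = 1) -> \int[mu]_z (f z)%:E = 1 ->
  (forall z, f_ n z @[n --> \oo] --> f z)%R ->
  \int[mu]_z (`|f_ n z - f z|%R)%:E @[n --> \oo] --> 0.
Proof.
move=> mf_ mf f_0 f0 f_1 f1 f_f.
have If : mu.-integrable setT (EFin \o f).
  by apply: integrable_density => //; rewrite f1 ltry.
(* |f_n - f| = 2 (f - f_n)^+ + (f_n - f), and the last term has integral 0. *)
pose h n z := Num.max (f z - f_ n z)%R 0%R.
have mh n : measurable_fun setT (h n).
  by apply: measurable_maxr => //; exact: measurable_funB.
have h0 n z : (0 <= h n z)%R by rewrite /h le_max lexx orbT.
have hf n z : (h n z <= f z)%R.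
  by rewrite /h ge_max f0 andbT lerBlDr lerDl.
have Ih n : mu.-integrable setT (EFin \o h n).
  apply: le_integrable If => //; first exact/measurable_EFinP.
  by move=> z _ /=; rewrite lee_fin !ger0_norm.
have eqh n : \int[mu]_z (`|f_ n z - f z|%R)%:E = 2%:E * \int[mu]_z (h n z)%:E.
  have If_ : mu.-integrable setT (EFin \o f_ n).
    by apply: integrable_density => //; rewrite f_1 ltry.
  transitivity (\int[mu]_z ((2 * h n z)%:E + ((f_ n z)%:E - (f z)%:E))).
    apply: eq_integral => z _; rewrite -EFinB -EFinD; congr (_%:E).
    rewrite /h; case: (leP (f z - f_ n z)%R 0%R) => [le0|gt0].
      by rewrite mulr0 add0r ger0_norm//; lra.
    by rewrite ltr0_norm; lra.
  rewrite integralD//=; last 2 first.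
    by have := integrableZl measurableT 2 (Ih n);
      apply: eq_integrable => // z _; rewrite /= EFinM.
    exact: integrableB If_ If.
  have := integralB measurableT If_ If; rewrite f_1 f1 subee//= => ->; rewrite adde0.
  under eq_integral do rewrite EFinM.
  by rewrite integralZl//=; exact: Ih.
suff : \int[mu]_z (h n z)%:E @[n --> \oo] --> 0.
  by move=> /(@cvgeZl _ _ _ _ _ 2%:E isT); rewrite mule0 (funext eqh).
have h_cvg z : (h n z)%:E @[n --> \oo] --> 0.
  apply/cvg_EFin; first exact: nearW.
  apply: (@squeeze_cvgr _ _ _ _ (fun=> 0%R) (fun n => `|f z - f_ n z|%R)).
  - by near=> n; rewrite /= h0/= /h ge_max ler_norm normr_ge0.
  - exact: cvg_cst.
  - rewrite -(@normr0 _ R) -(subrr (f z)); apply: cvg_norm.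
    by apply: cvgB => //; exact: cvg_cst.
have [|||||_ _] := @dominated_convergence _ _ _ mu setT measurableT
  (fun n z => (h n z)%:E) (cst 0) (EFin \o f).
- by move=> n; exact/measurable_EFinP.
- exact: measurable_cst.
- by apply: aeW => z _.
- exact: If.
- by apply: aeW => z n _ /=; rewrite lee_fin ger0_norm.
by rewrite integral_cst// mul0e.
Unshelve. all: by end_near. Qed.

End densities.

(** * Regularity of finite measures on the plane *)

Section regularity.
Context (R : realType) (nu : {measure set (R * R)%type -> \bar R}).
Local Open Scope ereal_scope.
Hypothesis nuT : nu setT < +oo.

(** The measurability of U and F is asked for explicitly: it spares the proof
    that open sets of the plane belong to the product sigma-algebra. *)
Definition regular_set (B : set (R * R)%type) : Prop :=
  measurable B /\ forall e : R, (0 < e)%R ->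
  exists U F : set (R * R)%type, [/\ open U, closed F, measurable U /\ measurable F,
    F `<=` B /\ B `<=` U & nu (U `\` F) <= e%:E].

Let regular0 : regular_set set0.
Proof.
split => // e e0; exists set0, set0.
split; [exact: open0|exact: closed0|split; exact: measurable0|
  by split; exact: subset_refl|].
by rewrite setD0 measure0 lee_fin ltW.
Qed.

Let regularC B : regular_set B -> regular_set (~` B).
Proof.
move=> [mB rB]; split; first exact: measurableC.
move=> e e0; have [U [F [oU cF [mU mF] [FB BU] le]]] := rB e e0.
exists (~` F), (~` U); split.
- exact: closed_openC.
- exact: open_closedC.
- by split; exact: measurableC.
- by split; exact: subsetC.
- by rewrite setDE setCK setIC -setDE.
Qed.

(** Continuity from above, in the form that lets a countable intersection be
    replaced by one of its terms. *)
Lemma decreasing_measure_le (A : (set (R * R)%type)^nat) (x e : R) :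
  (forall n, measurable (A n)) -> (forall m n, (m <= n)%N -> A n `<=` A m) ->
  nu (\bigcap_n A n) <= x%:E -> (0 < e)%R -> exists n, nu (A n) <= (x + e)%:E.
Proof.
move=> mA dA le e0.
have cv : nu (A n) @[n --> \oo] --> nu (\bigcap_n A n).
  apply: nonincreasing_cvg_mu => //.
  - by apply: le_lt_trans nuT; apply: le_measure; rewrite ?inE.
  - exact: bigcapT_measurable.
  - by move=> m n mn; apply/subsetPset; exact: dA.
apply: contrapT => /forallNP nle.
have : (x + e)%:E <= nu (\bigcap_n A n).
  rewrite -(cvg_lim _ cv)//; apply: lime_ge.
    by apply/cvg_ex; exists (nu (\bigcap_n A n)).
  by apply: nearW => n; rewrite ltW// ltNge; apply/negP/nle.
by apply/negP; rewrite -ltNge (le_lt_trans le)// lte_fin ltrDl.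
Qed.

(** The open sets are united as they are; of the closed sets only finitely many
    can be kept, which continuity from above makes harmless. *)
Let regular_bigcup (B : (set (R * R)%type)^nat) :
  (forall n, regular_set (B n)) -> regular_set (\bigcup_n B n).
Proof.
move=> rB; split; first by apply: bigcupT_measurable => n; have [] := rB n.
move=> e e0; have e20 : (0 < e / 2)%R by rewrite divr_gt0.
have en0 n : (0 < (e / 2) / (2 ^ n.+1)%:R)%R.
  by rewrite divr_gt0// ltr0n expn_gt0.
have /choice [OF HOF] : forall n, exists OF : ((set (R * R)) * (set (R * R)))%type,
    [/\ open OF.1, closed OF.2, measurable OF.1 /\ measurable OF.2,
    OF.2 `<=` B n /\ B n `<=` OF.1 &
    nu (OF.1 `\` OF.2) <= ((e / 2) / (2 ^ n.+1)%:R)%:E].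
  move=> n; have [_ /(_ _ (en0 n)) [U [F H]]] := rB n.
  by exists (U, F).
pose U := \bigcup_n (OF n).1.
pose F n := \bigcup_(i < n) (OF i).2.
have mU : measurable U by apply: bigcupT_measurable => n; have [_ _ []] := HOF n.
have mF n : measurable (F n).
  by apply: bigcup_measurable => i _; have [_ _ []] := HOF i.
have le2 : nu (\bigcap_n (U `\` F n)) <= (e / 2)%:E.
  apply: (@le_trans _ _ (\sum_(n <oo) nu ((OF n).1 `\` (OF n).2))).
    apply: measure_sigma_subadditive => //.
    - by move=> n; have [_ _ [? ?] _ _] := HOF n; exact: measurableD.
    - by apply: bigcapT_measurable => n; exact: measurableD.
    - move=> z Hz; have [[n _ On] _] := Hz 0%N I.
      exists n => //; split => // Fn.
      by have [_] := Hz n.+1 I; apply; exists n => /=.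
  apply: (@le_trans _ _ (\sum_(n <oo) (0 + ((e / 2) / (2 ^ n.+1)%:R)%:E))).
    apply: lee_nneseries => [n _ _|n _]; first exact: measure_ge0.
    by rewrite add0e; have [_ _ _ _] := HOF n.
  have et := @epsilon_trick R (fun=> 0) (e / 2)%R xpredT (fun=> lexx _) (ltW e20).
  apply: le_trans et _.
  by rewrite eseries0// add0e.
have [n len] : exists n, nu (U `\` F n) <= (e / 2 + e / 2)%:E.
  apply: (@decreasing_measure_le (fun n => U `\` F n)) le2 e20.
  - by move=> n; exact: measurableD.
  - move=> m n mn z [Oz Fz]; split => // -[i/= im Fi]; apply: Fz.
    by exists i => //=; exact: leq_trans mn.
exists U, (F n); split => //.
- by apply: bigcup_open => i _; have [] := HOF i.
- by rewrite /F bigcup_mkord; apply: closed_bigsetU => i _; have [_ ?] := HOF i.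
- split => z.
    by move=> [i _ Fi]; have [_ _ _ [FB _] _] := HOF i; exists i => //; exact: FB.
  by move=> [i _ Bi]; have [_ _ _ [_ BU] _] := HOF i; exists i => //; exact: BU.
- by move: len; rewrite -splitr.
Qed.

(** A half-line is open and is exhausted by closed half-lines; the half-lines
    generate the Borel sets. *)
Let regular_half_space (f : (R * R)%type -> R) (x : R) : continuous f ->
  measurable_fun setT f -> regular_set (f @^-1` `]x, +oo[).
Proof.
move=> cf mf.
have mpre A : measurable A -> measurable (f @^-1` A).
  by move=> mA; rewrite -[X in measurable X]setTI; exact: mf.
split; first exact: mpre.
move=> e e0.
pose F (n : nat) := f @^-1` `[(x + n.+1%:R^-1)%R, +oo[%classic.
have [n len] : exists n, nu (f @^-1` `]x, +oo[ `\` F n) <= (0 + e)%:E.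
  apply: (@decreasing_measure_le (fun n => f @^-1` `]x, +oo[ `\` F n)) => //.
  - by move=> n; apply: measurableD; exact: mpre.
  - move=> m n mn z [zx Fz]; split => // Fm; apply: Fz.
    move: Fm; rewrite /F /= !in_itv/= !andbT; apply: le_trans.
    by rewrite lerD2l lef_pV2 ?posrE// ler_nat ltnS.
  rewrite (_ : \bigcap_n _ = set0) ?measure0//.
  apply/seteqP; split => // z Hz.
  have [+ _] := Hz 0%N I; rewrite /= in_itv/= andbT => xz.
  have [n /= nle] : exists n : nat, (n.+1%:R^-1 <= f z - x)%R.
    have := ltr_add_invr xz => -[k]; exists k; rewrite lerBrDl; exact: ltW.
  by have [_] := Hz n I; apply; rewrite /F/= in_itv/= andbT -lerBrDl.
exists (f @^-1` `]x, +oo[), (F n); split => //.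
- by apply: open_comp => //; exact: interval_open.
- by apply: closed_comp => //; exact: interval_closed.
- by split; exact: mpre.
- split => // z; rewrite /F/= !in_itv/= !andbT; apply: lt_le_trans.
  by rewrite ltrDl invr_gt0.
- by rewrite add0r in len.
Qed.

Let regular_preimage (f : (R * R)%type -> R) (A : set R) : continuous f ->
  measurable_fun setT f -> measurable A -> regular_set (f @^-1` A).
Proof.
move=> cf mf.
have sub : <<s @RGenOInfty.G R >> `<=` [set A | regular_set (f @^-1` A)].
  apply: smallest_sub.
    split => /=.
    - by rewrite preimage_set0; exact: regular0.
    - by move=> X; rewrite setTD; exact: regularC.
    - by move=> X rX; rewrite preimage_bigcup; exact: regular_bigcup.
  by move=> _ [x ->]; exact: regular_half_space.
move=> mA; apply: sub.
suff : (@RGenOInfty.G R).-sigma.-measurable A by [].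
by rewrite -RGenOInfty.measurableE.
Qed.

Lemma measurable_regular (B : set (R * R)%type) : measurable B -> regular_set B.
Proof.
suff : @measurable _ (R * R)%type `<=` regular_set by apply.
apply: smallest_sub.
  split => //.
  - by move=> X; rewrite setTD; exact: regularC.
move=> _ [[A mA <-]|[A mA <-]]; rewrite setTI; apply: regular_preimage => //.
- by move=> z; exact: cvg_fst.
- by move=> z; exact: cvg_snd.
Qed.

(** Almost sure convergence controls open events only; this is how the control
    reaches all Borel events. *)
Lemma outer_regular (B : set (R * R)%type) (e : R) : measurable B -> (0 < e)%R ->
  exists U : set (R * R)%type, [/\ open U, measurable U, B `<=` U & nu U <= nu B + e%:E].
Proof.
move=> mB e0; have [_ /(_ e e0)] := measurable_regular mB.
move=> [U [F [oU cF [mU mF] [FB BU] le]]]; exists U; split => //.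
rewrite (_ : U = B `|` (U `\` B)); last by rewrite setDUK.
apply: le_trans (measureU2 _ _ _) _ => //; first exact: measurableD.
apply: leeD2l; apply: le_trans le; apply: le_measure; rewrite ?inE.
- exact: measurableD.
- exact: measurableD.
- by move=> z [Oz nB]; split => // /FB.
Qed.

End regularity.

(** * Measures with a density and their products *)

Section density_measure.
Context d (T : measurableType d) (R : realType).
Variables (mu : {measure set T -> \bar R}) (f : T -> R).
Hypotheses (mf : measurable_fun setT f) (f0 : forall z, 0 <= f z).
Local Open Scope ereal_scope.

(** The two hypotheses are arguments so that the measure structure, which needs
    them, can be inferred from the term. *)
Definition density_measure of measurable_fun setT f & (forall z, (0 <= f z)%R) :
    set T -> \bar R :=
  fun B => \int[mu]_(z in B) (f z)%:E.

Local Notation nu := (density_measure mf f0).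

Let nu0 : nu set0 = 0. Proof. exact: integral_set0. Qed.

Let nu_ge0 B : 0 <= nu B.
Proof. by apply: integral_ge0 => z _; rewrite lee_fin. Qed.

Let nu_sigma_additive : semi_sigma_additive nu.
Proof.
move=> A mA tA mUA; rewrite /density_measure ge0_integral_bigcup//=.
- by apply: is_cvg_ereal_nneg_natsum_cond => n _ _; exact: nu_ge0.
- by apply/measurable_EFinP; exact: measurable_funS mf.
- by move=> z _; rewrite lee_fin.
Qed.

HB.instance Definition _ := isMeasure.Build _ _ _ nu nu0 nu_ge0 nu_sigma_additive.

End density_measure.

Section product_density.
Context d1 d2 (T1 : measurableType d1) (T2 : measurableType d2) (R : realType).
Variables (mu1 nu1 : {sigma_finite_measure set T1 -> \bar R}).
Variables (mu2 nu2 : {sigma_finite_measure set T2 -> \bar R}).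
Variables (f1 : T1 -> R) (f2 : T2 -> R).
Hypotheses (mf1 : measurable_fun setT f1) (mf2 : measurable_fun setT f2).
Hypotheses (f10 : forall x, 0 <= f1 x) (f20 : forall y, 0 <= f2 y).
Local Open Scope ereal_scope.
Hypothesis nu1E : forall A, measurable A -> nu1 A = \int[mu1]_(x in A) (f1 x)%:E.
Hypothesis nu2E : forall B, measurable B -> nu2 B = \int[mu2]_(y in B) (f2 y)%:E.

Let f z := (f1 z.1 * f2 z.2)%R.
Let mf : measurable_fun setT f.
Proof.
by apply: measurable_funM; apply: measurableT_comp.
Qed.
Let f0 z : (0 <= f z)%R. Proof. exact: mulr_ge0. Qed.

Lemma product_measure_density C : measurable C ->
  (nu1 \x nu2) C = \int[mu1 \x mu2]_(z in C) (f1 z.1 * f2 z.2)%:E.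
Proof.
move=> mC.
pose nu : {measure set (T1 * T2) -> \bar R} := density_measure (mu1 \x mu2) mf f0.
suff rect A B : measurable A -> measurable B -> nu (A `*` B) = nu1 A * nu2 B.
  exact: (product_measure_unique rect mC).
move=> mA mB; rewrite /nu.
rewrite nu1E// nu2E// /density_measure/= [LHS]integral_mkcond.
rewrite fubini_tonelli1/=; last 2 first.
- apply/(measurable_restrictT _ _).1 => //; first exact: measurableX.
  by apply/measurable_EFinP; exact: measurable_funS mf.
- by move=> z; rewrite erestrict_ge0// => ? _; rewrite lee_fin.
transitivity (\int[mu1]_x ((f1 x * \1_A x)%:E * \int[mu2]_(y in B) (f2 y)%:E)).
  apply: eq_integral => x _; rewrite /fubini_F [in RHS]integral_mkcond.
  rewrite -ge0_integralZl//; last 3 first.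
  - apply/(measurable_restrictT _ _).1 => //.
    by apply/measurable_EFinP; exact: measurable_funS mf2.
  - by move=> y _; rewrite erestrict_ge0// => ? _; rewrite lee_fin.
  - by rewrite lee_fin mulr_ge0// indicE.
  apply: eq_integral => y _; rewrite /patch/= indicE in_setX/=.
  by case: (x \in A); case: (y \in B); rewrite ?mulr1 ?mulr0 ?mule0 ?mul0e.
rewrite ge0_integralZr//; last 3 first.
- by apply/measurable_EFinP; apply: measurable_funM.
- by move=> x _; rewrite lee_fin mulr_ge0// indicE.
- by apply: integral_ge0 => y _; rewrite lee_fin.
congr (_ * _); rewrite [in RHS]integral_mkcond.
apply: eq_integral => x _; rewrite /patch indicE.
by case: (x \in A); rewrite ?mulr1 ?mulr0.
Qed.

End product_density.

(** * Normal laws *)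

(** The pushforward with its measure structure, chosen by the proof of
    measurability. *)
Definition image_measure d1 d2 (T1 : measurableType d1) (T2 : measurableType d2)
    (R : realType) (mu : {measure set T1 -> \bar R}) (f : T1 -> T2)
    (mf : measurable_fun setT f) : {measure set T2 -> \bar R} :=
  measure_function_pushforward__canonical__measure_function_Measure mu mf.

(** Lebesgue measure lives on a copy of the real line; this identity map carries
    measures built from it back to the plane. *)
Lemma measurable_plane_id (R : realType) : measurable_fun setT
  (fun z : measurableTypeR R * measurableTypeR R => (z : R * R)).
Proof. by move=> _ Y mY; rewrite setTI. Qed.

Section normal_laws.
Context (R : realType).
Notation lambda := (@lebesgue_measure R).
Implicit Types (m s : R) (A B : set R).

Let affine m s (z : R) : R := m + s * z.

Let measurable_affine m s : measurable_fun setT (affine m s).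
Proof. by apply: measurable_funD => //; apply: measurable_funM. Qed.

Lemma lebesgue_measure_affine m s A : 0 < s -> measurable A ->
  lambda A = (s%:E * lambda ((fun z => (m + s * z)%R) @^-1` A))%E.
Proof.
move=> s0 mA.
pose phi : measurableTypeR R -> measurableTypeR R := affine m s.
have mphi : measurable_fun setT phi by exact: measurable_affine.
pose nu : {measure set (measurableTypeR R) -> \bar R} :=
  mscale (NngNum (ltW s0)) (image_measure lambda mphi).
suff H X : ocitv X -> lambda X = nu X.
  by have := lebesgue_measure_unique H mA => /= ->.
move=> [[a b]] _ <-; rewrite /nu /= /mscale/= /pushforward.
have -> : phi @^-1` [set` `]a, b]] = [set` `](a - m) / s, (b - m) / s]].
  apply/seteqP; split => z /=; rewrite /phi /affine !in_itv/= ltr_pdivrMr// ler_pdivlMr//;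
  by rewrite ltrBlDl lerBrDl (mulrC z).
rewrite /= !lebesgue_measure_itv/= !lte_fin ltr_pM2r ?invr_gt0// ltrD2r.
case: ifP => _; last by rewrite mule0.
by rewrite -!EFinB -EFinM; congr (_%:E); field; rewrite gt_eqF.
Qed.

(** The law of m + s Z with Z standard normal. Unlike [normal_prob m s] it is the
    Dirac mass at m when s = 0, so an empty sum has such a law too. *)
Definition affine_normal m s : set R -> \bar R :=
  fun A => normal_prob 0 1 ((fun z : R => m + s * z) @^-1` A).

Lemma normal_pdf_affine m s z : 0 < s ->
  s * normal_pdf m s (m + s * z) = normal_pdf 0 1 z.
Proof.
move=> s0; have sn0 : s != 0 by rewrite gt_eqF.
rewrite !normal_pdfE ?oner_eq0// /normal_peak /normal_fun mulrA.
congr (_ * expR _); last by field.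
rewrite expr1n mul1r -mulrnAr sqrtrM ?sqr_ge0// sqrtr_sqr gtr0_norm//.
by rewrite invfM mulrA mulfV// mul1r.
Qed.

Lemma normal_prob_affine m s A : 0 < s -> measurable A ->
  normal_prob m s A = affine_normal m s A.
Proof.
move=> s0 mA; rewrite /affine_normal /normal_prob.
pose phi : measurableTypeR R -> measurableTypeR R := affine m s.
have mphi : measurable_fun setT phi by exact: measurable_affine.
pose nu : {measure set (measurableTypeR R) -> \bar R} :=
  mscale (NngNum (ltW s0)) (image_measure lambda mphi).
have mpdf (B : set R) m' s' : measurable_fun B (EFin \o normal_pdf m' s').
  by apply/measurable_EFinP; apply: measurable_funS (measurable_normal_pdf _ _).
rewrite (@eq_measure_integral _ (measurableTypeR R) R A nu)/=; last first.
  by move=> X mX _; exact: lebesgue_measure_affine.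
rewrite ge0_integral_mscale//=; last 2 first.
- exact: mpdf.
- by move=> x _; rewrite lee_fin normal_pdf_ge0.
rewrite ge0_integral_pushforward//=; last 2 first.
- exact: mpdf.
- by move=> x _; rewrite lee_fin normal_pdf_ge0.
rewrite -ge0_integralZl//=.
- by apply: eq_integral => z _; rewrite -EFinM normal_pdf_affine.
- by rewrite -[X in measurable X]setTI; exact: (measurable_affine m s).
- apply: measurableT_comp => //; apply: measurable_funS (@subsetT _ _) _ => //.
  by apply: measurableT_comp (measurable_affine m s); exact: measurable_normal_pdf.
- by move=> x _; rewrite lee_fin normal_pdf_ge0.
- by rewrite lee_fin ltW.
Qed.

(** Completing the square: the left-hand side is the density of (Z, s Z + s' Z')
    for independent standard Z and Z'; on the right it is factored through its
    second marginal. *)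
Lemma normal_pdf_disintegration s s' z x : 0 < s -> 0 < s' ->
  normal_pdf 0 1 z * normal_pdf (s * z) s' x =
  normal_pdf 0 (Num.sqrt (s ^+ 2 + s' ^+ 2)) x *
  normal_pdf (s * x / (s ^+ 2 + s' ^+ 2)) (s' / Num.sqrt (s ^+ 2 + s' ^+ 2)) z.
Proof.
move=> s0 s'0; set S := Num.sqrt _.
have S2 : S ^+ 2 = s ^+ 2 + s' ^+ 2 by rewrite sqr_sqrtr// addr_ge0// sqr_ge0.
have S0 : 0 < S by rewrite sqrtr_gt0 addr_gt0// exprn_gt0.
have Sn0 : S != 0 by rewrite gt_eqF.
have sn0 : s' != 0 by rewrite gt_eqF.
have Q0 : s ^+ 2 + s' ^+ 2 != 0 by rewrite -S2 expf_neq0.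
rewrite !normal_pdfE ?oner_eq0// ?mulf_neq0 ?invr_neq0//.
rewrite /normal_peak /normal_fun mulrACA [RHS]mulrACA -!expRD.
congr (_ * expR _).
  rewrite -!invfM; congr (_^-1).
  rewrite -!sqrtrM ?mulrn_wge0// ?mulr_ge0 ?sqr_ge0 ?pi_ge0//.
  by congr Num.sqrt; rewrite exprMn exprVn S2; field; rewrite Q0.
  all: try exact: ltW.
rewrite !exprMn exprVn S2; field.
by rewrite Q0 sn0.
Qed.

Lemma normal_product_density m s m' s' (C : set (R * R)) : measurable C ->
  (normal_prob m s \x normal_prob m' s')%E C =
  (\int[lambda \x lambda]_(z in C) (normal_pdf m s z.1 * normal_pdf m' s' z.2)%:E)%E.
Proof.
move=> mC; apply: product_measure_density => //;
  exact: measurable_normal_pdf || exact: normal_pdf_ge0.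
Qed.

(** Integrating the factored density of (Z, s Z + s' Z') over its first variable
    leaves the density of a single normal variable. *)
Lemma normal_rotation s s' A : 0 < s -> 0 < s' -> measurable A ->
  (normal_prob (0 : R) 1 \x normal_prob (0 : R) 1)%E
    [set z | A (s * z.1 + s' * z.2)] =
  normal_prob 0 (Num.sqrt (s ^+ 2 + s' ^+ 2)) A.
Proof.
move=> s0 s'0 mA; set S := Num.sqrt _.
have mC : measurable [set z : R * R | A (s * z.1 + s' * z.2)].
  have mf : measurable_fun setT (fun z : R * R => s * z.1 + s' * z.2).
    by apply: measurable_funD; apply: measurable_funM.
  by rewrite -[X in measurable X]setTI; exact: mf.
have pdf_ge0 := @normal_pdf_ge0 R.
have mpdf := @measurable_normal_pdf R.
rewrite normal_product_density//.
rewrite integral_mkcond fubini_tonelli1/=; last 2 first.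
- apply/(measurable_restrictT _ _).1 => //; apply/measurable_EFinP.
  apply: (measurable_funS measurableT) => //.
  apply: measurable_funM.
    exact: (measurableT_comp (mpdf 0 1) measurable_fst).
  exact: (measurableT_comp (mpdf 0 1) measurable_snd).
- by move=> z; rewrite erestrict_ge0// => ? _; rewrite lee_fin mulr_ge0.
(* h is the density of (Z, s Z + s' Z') cut off by the event on its second variable. *)
pose h (z : R * R) : \bar R :=
  ((normal_pdf 0 1 z.1 * normal_pdf (s * z.1) s' z.2 * \1_A z.2)%:E).
have mh : measurable_fun setT h.
  apply/measurable_EFinP; apply: measurable_funM.
    apply: measurable_funM.
      exact: (measurableT_comp (mpdf 0 1) measurable_fst).
    have -> : (fun z : R * R => normal_pdf (s * z.1) s' z.2) =
              normal_pdf 0 s' \o (fun z => z.2 - s * z.1).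
      apply/funext => z /=; rewrite !normal_pdfE ?gt_eqF//.
      by rewrite /normal_fun subr0.
    apply: measurableT_comp => //; apply: measurable_funB => //.
    exact: measurable_funM.
  have mI : measurable_fun setT (\1_A : R -> R) by exact: measurable_indic.
  exact: (measurableT_comp mI measurable_snd).
have h0 z : (0 <= h z)%E by rewrite lee_fin !mulr_ge0// indicE.
transitivity (\int[lambda \x lambda]_z h z)%E.
  rewrite fubini_tonelli1; [|exact: mh|exact: h0].
  apply: eq_integral => z _; rewrite /fubini_F /=.
  transitivity ((normal_pdf 0 1 z)%:E * normal_prob (s * z) s' A)%E; last first.
    rewrite /normal_prob integral_mkcond -ge0_integralZl//; last 3 first.
    + apply/(measurable_restrictT _ _).1 => //; apply/measurable_EFinP.
      exact: measurable_funS (mpdf _ _).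
    + by move=> y _; rewrite erestrict_ge0// => ? _; rewrite lee_fin.
    + by rewrite lee_fin.
    apply: eq_integral => y _; rewrite /h /patch/= indicE.
    by case: (y \in A); rewrite ?mulr1 ?mulr0 ?mule0.
  rewrite normal_prob_affine// /affine_normal /normal_prob [X in (_ * X)%E]integral_mkcond.
  rewrite -ge0_integralZl//; last 3 first.
  + apply/(measurable_restrictT _ _).1 => //; last first.
      by apply/measurable_EFinP; exact: measurable_funS (mpdf _ _).
    by rewrite -[X in measurable X]setTI; exact: (measurable_affine (s * z) s').
  + by move=> y _; rewrite erestrict_ge0// => ? _; rewrite lee_fin.
  + by rewrite lee_fin.
  apply: eq_integral => y _; rewrite /patch/=.
  have -> : ((z, y) \in [set z | A (s * z.1 + s' * z.2)]) =
            (y \in (fun z0 => s * z + s' * z0) @^-1` A) by [].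
  by case: ifPn; rewrite ?mule0.
rewrite fubini_tonelli2; [|exact: mh|exact: h0].
rewrite /normal_prob [RHS]integral_mkcond.
apply: eq_integral => x _; rewrite /fubini_G.
rewrite /h /=.
transitivity (\int[lambda]_z ((normal_pdf 0 S x * \1_A x)%:E *
   (normal_pdf (s * x / (s ^+ 2 + s' ^+ 2)) (s' / S) z)%:E))%E.
  apply: eq_integral => z _; rewrite -EFinM normal_pdf_disintegration//.
  by congr (_%:E); ring.
rewrite ge0_integralZl//; last 3 first.
- by apply/measurable_EFinP; exact: mpdf.
- by move=> z _; rewrite lee_fin.
- by rewrite lee_fin mulr_ge0// indicE.
rewrite integral_normal_pdf mule1 /patch indicE.
by case: (x \in A); rewrite ?mulr1 ?mulr0.
Qed.

Let affine_normalE m s :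
  affine_normal m s = image_measure (normal_prob 0 1) (measurable_affine m s).
Proof. by []. Qed.

Let affine_normal0 m s : affine_normal m s set0 = 0%E.
Proof. by rewrite affine_normalE measure0. Qed.

Let affine_normal_ge0 m s A : (0 <= affine_normal m s A)%E.
Proof. by rewrite affine_normalE; exact: measure_ge0. Qed.

Let affine_normal_sigma_additive m s : semi_sigma_additive (affine_normal m s).
Proof. by rewrite affine_normalE; exact: measure_semi_sigma_additive. Qed.

HB.instance Definition _ m s := isMeasure.Build _ _ _ (affine_normal m s)
  (affine_normal0 m s) (affine_normal_ge0 m s)
  (@affine_normal_sigma_additive m s).

Let affine_normalT m s : affine_normal m s setT = 1%E.
Proof. by rewrite /affine_normal preimage_setT probability_setT. Qed.

HB.instance Definition _ m s :=
  Measure_isProbability.Build _ _ R (affine_normal m s) (affine_normalT m s).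

Lemma affine_normal_degenerate m A : measurable A ->
  affine_normal m 0 A = (\1_A m)%:E.
Proof.
move=> mA; rewrite /affine_normal indicE.
case: (boolP (m \in A)) => mA'.
  rewrite (_ : _ @^-1` _ = setT) ?probability_setT//.
  by apply/seteqP; split => // z _ /=; rewrite mul0r addr0; exact: set_mem.
rewrite (_ : _ @^-1` _ = set0) ?measure0//.
apply/seteqP; split => // z /=; rewrite mul0r addr0 => Am.
by move/negP: mA'; apply; exact: mem_set.
Qed.

Lemma affine_normal_shift m s a A : measurable A ->
  affine_normal (a + m) s A = affine_normal m s ((fun x => a + x) @^-1` A).
Proof.
move=> mA; congr normal_prob; apply/seteqP; split => z /=; by rewrite addrA.
Qed.

End normal_laws.

(** * Sums of independent normal variables *)

Section joint_law.
Context d (T : measurableType d) (R : realType) (P : probability T R).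
Context d1 d2 (T1 : measurableType d1) (T2 : measurableType d2).
Variables (mu : probability T1 R) (nu : probability T2 R).
Local Open Scope ereal_scope.

(** The product rule on rectangles, relative to an event E, determines the joint
    law on E. Working on E with the weight q replaces conditioning on E. *)
Lemma joint_law (E : set T) (X : T -> T1) (Y : T -> T2) (q : R) :
  measurable E -> measurable_fun setT X -> measurable_fun setT Y ->
  (0 <= q)%R ->
  (forall A B, measurable A -> measurable B ->
     P (E `&` (X @^-1` A `&` Y @^-1` B)) = q%:E * (mu A * nu B)) ->
  forall C, measurable C ->
    P (E `&` (fun w => (X w, Y w)) @^-1` C) = q%:E * (mu \x nu) C.
Proof.
move=> mE mX mY q0 rect C mC.
have mXY : measurable_fun setT (fun w => (X w, Y w)).
  exact/measurable_fun_pairP.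
have mXYC : measurable ((fun w => (X w, Y w)) @^-1` C).
  by rewrite -[X in measurable X]setTI; exact: mXY.
(* For q > 0 the uniqueness of product measures applies after division by q. *)
move: q0; rewrite le_eqVlt => /predU1P[q0|q0].
  rewrite -q0 mul0e; apply: (@subset_measure0 _ _ _ P _ E) => //.
  - exact: measurableI.
  - by have := rect setT setT measurableT measurableT;
      rewrite !preimage_setT !setIT -q0 mul0e.
have qi0 : (0 <= q^-1)%R by rewrite invr_ge0 ltW.
pose m : {measure set (T1 * T2) -> \bar R} :=
  mscale (NngNum qi0) (image_measure (mrestr P mE) mXY).
have mE' D : m D = q^-1%:E * P (E `&` (fun w => (X w, Y w)) @^-1` D).
  by rewrite /m/= /mscale/= /pushforward /mrestr setIC.
have H A B : measurable A -> measurable B -> m (A `*` B) = mu A * nu B.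
  move=> mA mB; rewrite mE' (rect A B)// muleA -EFinM mulVf ?gt_eqF// mul1e//.
by rewrite (product_measure_unique H mC) mE' muleA -EFinM divff ?gt_eqF// mul1e.
Qed.

End joint_law.

Section affine_normal_sum.
Context (R : realType).
Implicit Types (m s : R) (A B : set R).

Lemma affine_normal_sum m s m' s' A : 0 <= s -> 0 <= s' -> measurable A ->
  (affine_normal m s \x affine_normal m' s')%E [set z | A (z.1 + z.2)] =
  affine_normal (m + m') (Num.sqrt (s ^+ 2 + s' ^+ 2)) A.
Proof.
move=> s0 s'0 mA.
(* Both laws are images of standard normal laws, so the product of the two is the
   image under phi of the standard planar law. *)
pose phi (z : R * R) := (m + s * z.1, m' + s' * z.2).
have mphi : measurable_fun setT phi.
  by apply/measurable_fun_pairP; split; apply: measurable_funD => //;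
    apply: measurable_funM.
have maff a b : measurable_fun setT (fun x : R => a + b * x).
  by apply: measurable_funD => //; apply: measurable_funM.
have mC : measurable [set z : R * R | A (z.1 + z.2)].
  have mf : measurable_fun setT (fun z : R * R => z.1 + z.2).
    exact: measurable_funD.
  by rewrite -[X in measurable X]setTI; exact: mf.
pose gauss : probability (measurableTypeR R) R := normal_prob (0 : R) 1.
pose nu : {measure set (R * R) -> \bar R} := image_measure (gauss \x gauss)%E mphi.
have H (B C : set R) : measurable B -> measurable C ->
    nu (B `*` C) = (affine_normal m s B * affine_normal m' s' C)%E.
  move=> mB mC'; rewrite /nu /= /pushforward.
  rewrite (_ : _ @^-1` _ = ((fun x => m + s * x) @^-1` B) `*`
    ((fun x => m' + s' * x) @^-1` C))//.
  by rewrite product_measure1E//; rewrite -[X in measurable X]setTI; exact: maff.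
rewrite (product_measure_unique H mC) /nu/= /pushforward.
have mm (f : R -> R) (D : set R) : measurable_fun setT f -> measurable D ->
    measurable (f @^-1` D) by move=> mf mD; rewrite -[X in measurable X]setTI; exact: mf.
have mS : measurable ((fun x => m + m' + x) @^-1` A).
  have -> : (fun x => m + m' + x) = (fun x => m + m' + 1 * x).
    by apply/funext => x; rewrite mul1r.
  exact: mm (maff _ _) mA.
move: s0; rewrite le_eqVlt => /predU1P[sE|s0].
  rewrite -sE expr0n add0r sqrtr_sqr ger0_norm//.
  rewrite (_ : _ @^-1` _ = setT `*` ((fun x => (m + m') + s' * x) @^-1` A)).
    rewrite product_measure1E//; last exact: mm (maff _ _) mA.
    transitivity (gauss setT * affine_normal (m + m') s' A)%E => //.
    by rewrite probability_setT mul1e.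
  by apply/seteqP; split => z; rewrite /phi/= -sE mul0r addr0 addrA => // -[].
move: s'0; rewrite le_eqVlt => /predU1P[sE|s'0].
  rewrite -sE expr0n addr0 sqrtr_sqr gtr0_norm//.
  rewrite (_ : _ @^-1` _ = ((fun x => (m + m') + s * x) @^-1` A) `*` setT).
    rewrite product_measure1E//; last exact: mm (maff _ _) mA.
    transitivity (affine_normal (m + m') s A * gauss setT)%E => //.
    by rewrite probability_setT mule1.
  by apply/seteqP; split => z; rewrite /phi/= -sE mul0r addr0 addrAC => // -[].
rewrite (_ : _ @^-1` _ = [set z | ((fun x => m + m' + x) @^-1` A)
    (s * z.1 + s' * z.2)]); last first.
  by apply/seteqP; split => z; rewrite /phi/= addrACA.
rewrite [LHS]normal_rotation// normal_prob_affine// ?sqrtr_gt0 ?addr_gt0 ?exprn_gt0//.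
by rewrite -affine_normal_shift// addr0.
Qed.

End affine_normal_sum.

Section independent_sum.
Context d (T : measurableType d) (R : realType) (P : probability T R).
Local Open Scope ereal_scope.

Lemma indep_normal_sum (E : set T) (X Y : T -> R) (q m s m' s' : R) :
  measurable E -> measurable_fun setT X -> measurable_fun setT Y ->
  (0 <= q)%R -> (0 <= s)%R -> (0 <= s')%R ->
  (forall A B, measurable A -> measurable B ->
     P (E `&` (X @^-1` A `&` Y @^-1` B)) =
     q%:E * (affine_normal m s A * affine_normal m' s' B)) ->
  forall A, measurable A ->
    P (E `&` (fun w => X w + Y w)%R @^-1` A) =
    q%:E * affine_normal (m + m') (Num.sqrt (s ^+ 2 + s' ^+ 2)) A.
Proof.
move=> mE mX mY q0 s0 s'0 rect A mA.
rewrite -affine_normal_sum//.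
rewrite -(joint_law mE mX mY q0 rect)//.
have mf : measurable_fun setT (fun z : R * R => z.1 + z.2)%R.
  exact: measurable_funD.
by rewrite -[X in measurable X]setTI; exact: mf.
Qed.

End independent_sum.

(** * Splitting increments between two sums *)

Section signed_sums.
Context d (T : measurableType d) (R : realType) (P : probability T R).
Local Open Scope ereal_scope.

Let mpre (f : T -> R) (A : set R) :
  measurable_fun setT f -> measurable A -> measurable (f @^-1` A).
Proof. by move=> mf mA; rewrite -[X in measurable X]setTI; exact: mf. Qed.

Let law (m s : R) A := fine (affine_normal m s A).

Let law_ge0 m s A : (0 <= law m s A)%R.
Proof. by rewrite fine_ge0. Qed.

Let lawK m s A : measurable A -> (law m s A)%:E = affine_normal m s A.
Proof. by move=> mA; rewrite /law fineK// fin_num_measure. Qed.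

(** Both sums grow by one independent term. Each of the two applications of
    [indep_normal_sum] puts the events on the other sum into E. *)
Lemma indep_normal_sum_pair (E : set T) (X Y X' Y' : T -> R)
    (q m s n r m' s' n' r' : R) :
  measurable E -> measurable_fun setT X -> measurable_fun setT Y ->
  measurable_fun setT X' -> measurable_fun setT Y' ->
  (0 <= q)%R -> (0 <= s)%R -> (0 <= r)%R -> (0 <= s')%R -> (0 <= r')%R ->
  (forall A B A' B',
     measurable A -> measurable B -> measurable A' -> measurable B' ->
     P (E `&` ((X @^-1` A `&` Y @^-1` B) `&` (X' @^-1` A' `&` Y' @^-1` B'))) =
     q%:E * (affine_normal m s A * affine_normal n r B *
             (affine_normal m' s' A' * affine_normal n' r' B'))) ->
  forall A B, measurable A -> measurable B ->
    P (E `&` ((fun w => X w + X' w)%R @^-1` A `&`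
              (fun w => Y w + Y' w)%R @^-1` B)) =
    q%:E * (affine_normal (m + m') (Num.sqrt (s ^+ 2 + s' ^+ 2)) A *
            affine_normal (n + n') (Num.sqrt (r ^+ 2 + r' ^+ 2)) B).
Proof.
move=> mE mX mY mX' mY' q0 s0 r0 s'0 r'0 rule A B mA mB.
set lB := affine_normal (n + n') _ B.
have mYY' : measurable ((fun w => Y w + Y' w)%R @^-1` B).
  by apply: mpre => //; exact: measurable_funD.
rewrite (setIC (_ @^-1` A)) setIA.
have qB : q%:E * lB = (q * fine lB)%:E by rewrite EFinM fineK// fin_num_measure.
rewrite (muleC _ lB) muleA qB.
apply: indep_normal_sum => //.
- exact: measurableI.
- by apply: mulr_ge0 => //; apply: fine_ge0; exact: measure_ge0.
move=> C C' mC mC'; rewrite -qB.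
rewrite setIAC (_ : q%:E * lB * _ = (q * (law m s C * law m' s' C'))%:E * lB); last first.
  by rewrite 2!EFinM !lawK// -muleA (muleC lB) muleA.
apply: indep_normal_sum => //.
- by apply: measurableI => //; apply: measurableI; exact: mpre.
- by rewrite !mulr_ge0.
move=> D D' mD mD'; rewrite 2!EFinM !lawK//.
rewrite -setIA setIACA rule// -(muleA q%:E); congr (_ * _).
by rewrite muleACA.
Qed.

(** The position, up to its starting point, of a particle which receives the
    increments g1 at the steps selected by c and the increments g2 at the others. *)
Definition select_sum (c : nat -> bool) (g1 g2 : nat -> R) (n : nat) : R :=
  (\sum_(i < n) if c i then g1 i else g2 i)%R.

Lemma select_sumS c g1 g2 n : select_sum c g1 g2 n.+1 =
  (select_sum c g1 g2 n + if c n then g1 n else g2 n)%R.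
Proof. by rewrite /select_sum big_ord_recr. Qed.

Lemma select_sum_cst_ge0 c (x y : R) n : (0 <= x)%R -> (0 <= y)%R ->
  (0 <= select_sum c (fun=> x) (fun=> y) n)%R.
Proof. by move=> x0 y0; apply: sumr_ge0 => i _; case: ifP. Qed.

Variables (G1 G2 : nat -> T -> R) (c : nat -> bool) (m1 s1 m2 s2 u0 v0 : R).
Hypotheses (mG1 : forall i, measurable_fun setT (G1 i)).
Hypotheses (mG2 : forall i, measurable_fun setT (G2 i)).
Hypotheses (s1_ge0 : (0 <= s1)%R) (s2_ge0 : (0 <= s2)%R).

Let U n w := (u0 + select_sum c (G1 ^~ w) (G2 ^~ w) n)%R.
Let V n w := (v0 + select_sum (negb \o c) (G1 ^~ w) (G2 ^~ w) n)%R.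

Lemma measurable_select_sum c' n :
  measurable_fun setT (fun w => select_sum c' (G1 ^~ w) (G2 ^~ w) n).
Proof.
by apply: measurable_sum => i; case: (c' i).
Qed.

(** At each step one increment goes to U and the other to V, so U and V never share
    an increment: they stay independent and normal. The induction is on the number
    of steps, with the events on the last pair of increments moved into E. *)
Lemma select_sum_law n (E : set T) (q : R) : measurable E -> (0 <= q)%R ->
  (forall A B : nat -> set R,
     (forall i, measurable (A i)) -> (forall i, measurable (B i)) ->
     P (E `&` (\bigcap_(i < n) G1 i @^-1` A i `&` \bigcap_(i < n) G2 i @^-1` B i)) =
     q%:E * (\prod_(i < n) affine_normal m1 s1 (A i) *
             \prod_(i < n) affine_normal m2 s2 (B i))) ->
  forall A B, measurable A -> measurable B ->
    P (E `&` (U n @^-1` A `&` V n @^-1` B)) =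
    q%:E * (affine_normal (u0 + select_sum c (fun=> m1) (fun=> m2) n)
              (Num.sqrt (select_sum c (fun=> s1 ^+ 2)%R (fun=> s2 ^+ 2)%R n)) A *
            affine_normal (v0 + select_sum (negb \o c) (fun=> m1) (fun=> m2) n)
              (Num.sqrt (select_sum (negb \o c) (fun=> s1 ^+ 2)%R (fun=> s2 ^+ 2)%R n)) B).
Proof.
have sq0 (x : R) : (0 <= x ^+ 2)%R by exact: sqr_ge0.
elim: n E q => [|n IH] E q mE q0 rule A B mA mB.
  have := rule (fun=> setT) (fun=> setT) (fun=> measurableT) (fun=> measurableT).
  rewrite !big_ord0 !bigcap_mkord !big_ord0 !setIT mule1 => PE.
  have -> : U 0 = fun=> u0 by apply/funext => w; rewrite /U /select_sum big_ord0 addr0.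
  have -> : V 0 = fun=> v0 by apply/funext => w; rewrite /V /select_sum big_ord0 addr0.
  rewrite /select_sum !big_ord0 !addr0 sqrtr0 !affine_normal_degenerate//.
  rewrite !indicE -EFinM.
  have cstE (D : set R) x : (fun=> x) @^-1` D = if x \in D then [set: T] else set0.
    by rewrite preimage_cst.
  rewrite !cstE; case: ifP => _; case: ifP => _;
    by rewrite ?setIT ?setI0 ?set0I ?setTI ?PE ?mulr1 ?mulr0 ?mule1 ?mule0 ?measure0.
have step A' B' : measurable A' -> measurable B' ->
    forall C D, measurable C -> measurable D ->
    P (E `&` ((U n @^-1` C `&` V n @^-1` D) `&` (G1 n @^-1` A' `&` G2 n @^-1` B'))) =
    q%:E * (affine_normal (u0 + select_sum c (fun=> m1) (fun=> m2) n)
              (Num.sqrt (select_sum c (fun=> s1 ^+ 2)%R (fun=> s2 ^+ 2)%R n)) C *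
            affine_normal (v0 + select_sum (negb \o c) (fun=> m1) (fun=> m2) n)
              (Num.sqrt (select_sum (negb \o c) (fun=> s1 ^+ 2)%R (fun=> s2 ^+ 2)%R n)) D *
            (affine_normal m1 s1 A' * affine_normal m2 s2 B')).
  move=> mA' mB' C D mC mD.
  have q'0 : (0 <= q * (law m1 s1 A' * law m2 s2 B'))%R by rewrite !mulr_ge0.
  have mE' : measurable (E `&` (G1 n @^-1` A' `&` G2 n @^-1` B')).
    by apply: measurableI => //; apply: measurableI; exact: mpre.
  rewrite [X in E `&` X]setIC setIA (IH _ _ mE' q'0)//.
    by rewrite 2!EFinM !lawK// -(muleA q%:E); congr (_ * _); rewrite muleC.
  move=> A2 B2 mA2 mB2.
  have := rule (fun i => if i == n then A' else A2 i)
    (fun i => if i == n then B' else B2 i).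
  rewrite !bigcap_mkord !big_ord_recr/= eqxx => rule'.
  rewrite -setIA setIACA (setIC (G1 n @^-1` A')) (setIC (G2 n @^-1` B')).
  have eqP (F : nat -> T -> R) (A3 : nat -> set R) X :
    \big[setI/setT]_(i < n) F i @^-1` (if i == n :> nat then X else A3 i) =
    \big[setI/setT]_(i < n) F i @^-1` A3 i.
    by apply: eq_bigr => i _; rewrite ltn_eqF.
  have eqL (A3 : nat -> set R) X mm ss :
    \prod_(i < n) affine_normal mm ss (if i == n :> nat then X else A3 i) =
    \prod_(i < n) affine_normal mm ss (A3 i).
    by apply: eq_bigr => i _; rewrite ltn_eqF.
  move: rule'; rewrite !eqP !eqL => ->.
  - rewrite 2!EFinM !lawK// -(muleA q%:E); congr (_ * _).
    by rewrite [RHS]muleC muleACA.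
  - by move=> i; case: ifP.
  - by move=> i; case: ifP.
have rU c' : measurable_fun setT (fun w => select_sum c' (G1 ^~ w) (G2 ^~ w) n).
  exact: measurable_select_sum.
have mU : measurable_fun setT (U n) by exact: measurable_funD.
have mV : measurable_fun setT (V n) by exact: measurable_funD.
have ss0 c' : (0 <= select_sum c' (fun=> s1 ^+ 2) (fun=> s2 ^+ 2) n)%R.
  exact: select_sum_cst_ge0.
case cn : (c n).
- have -> : U n.+1 = fun w => (U n w + G1 n w)%R.
    by apply/funext => w; rewrite /U select_sumS cn addrA.
  have -> : V n.+1 = fun w => (V n w + G2 n w)%R.
    by apply/funext => w; rewrite /V select_sumS /= cn addrA.
  have st A1 B1 A2 B2 mA1 mB1 mA2 mB2 := step A2 B2 mA2 mB2 A1 B1 mA1 mB1.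
  rewrite (indep_normal_sum_pair mE mU mV (mG1 n) (mG2 n) q0 (sqrtr_ge0 _) (sqrtr_ge0 _)
    s1_ge0 s2_ge0 st mA mB).
  rewrite (sqr_sqrtr (ss0 c)) (sqr_sqrtr (ss0 (negb \o c))).
  by rewrite !select_sumS /= cn (addrA u0) (addrA v0).
- have -> : U n.+1 = fun w => (U n w + G2 n w)%R.
    by apply/funext => w; rewrite /U select_sumS cn addrA.
  have -> : V n.+1 = fun w => (V n w + G1 n w)%R.
    by apply/funext => w; rewrite /V select_sumS /= cn addrA.
  have st A1 B1 A2 B2 mA1 mB1 mA2 mB2 := step B2 A2 mB2 mA2 A1 B1 mA1 mB1.
  have {}st A1 B1 A2 B2 mA1 mB1 mA2 mB2 := etrans (congr1 (fun S =>
    P (E `&` (U n @^-1` A1 `&` V n @^-1` B1 `&` S)))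
      (setIC (G2 n @^-1` A2) (G1 n @^-1` B2)))
    (etrans (st A1 B1 A2 B2 mA1 mB1 mA2 mB2) (congr1 (fun x => q%:E * (_ * x))
      (muleC (affine_normal m1 s1 B2) (affine_normal m2 s2 A2)))).
  rewrite (indep_normal_sum_pair mE mU mV (mG2 n) (mG1 n) q0 (sqrtr_ge0 _) (sqrtr_ge0 _)
    s2_ge0 s1_ge0 st mA mB).
  rewrite (sqr_sqrtr (ss0 c)) (sqr_sqrtr (ss0 (negb \o c))).
  by rewrite !select_sumS /= cn (addrA u0) (addrA v0).
Qed.

End signed_sums.

(** * Averages over random jump patterns *)

Section random_signs.
Context (R : realFieldType) (n : nat) (p : R).
Implicit Types b : {ffun 'I_n -> bool}.

(** The probability of the pattern b of jumps when the steps jump independently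
    with probability p. *)
Definition jump_weight b : R := \prod_(j < n) (if b j then p else 1 - p).

Definition jump_sign b (i : nat) : R := \prod_(j < n | (j < i)%N) (-1) ^+ b j.

Let r := 1 - 2 * p.

Lemma jump_weight_ge0 b : 0 <= p <= 1 -> 0 <= jump_weight b.
Proof.
by move=> /andP[p0 p1]; apply: prodr_ge0 => j _; case: ifP => _; rewrite ?subr_ge0.
Qed.

Lemma jump_sign0 b : jump_sign b 0 = 1.
Proof. by apply: big1 => j; rewrite ltn0. Qed.

Lemma jump_sign_sqr b i : jump_sign b i ^+ 2 = 1.
Proof.
rewrite /jump_sign -prodrXl big1// => j _.
by rewrite -exprM mulnC exprM sqrrN expr1n expr1n.
Qed.

(** The jumps before i count twice and cancel; each step between i and k
    contributes the factor (1 - p) - p. *)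
Lemma jump_sign_correlation i k : (i <= k)%N -> (k <= n)%N ->
  \sum_b jump_weight b * (jump_sign b i * jump_sign b k) = r ^+ (k - i).
Proof.
move=> ik kn.
pose G (j : 'I_n) (c : bool) : R := (if c then p else 1 - p) *
  ((if (j < i)%N then (-1) ^+ c else 1) * (if (j < k)%N then (-1) ^+ c else 1)).
transitivity (\sum_(b : {ffun 'I_n -> bool}) \prod_j G j (b j)).
  apply: eq_bigr => b _; rewrite /jump_weight /jump_sign.
  by rewrite (big_mkcond (fun j : 'I_n => (j < i)%N))
    (big_mkcond (fun j : 'I_n => (j < k)%N)) -!big_split.
rewrite -bigA_distr_bigA/=.
transitivity (\prod_(j < n) (if (i <= j < k)%N then r else 1)).
  apply: eq_bigr => j _; rewrite big_bool /G /=.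
  case: (ltnP j i) => ji /=; first by rewrite (leq_trans ji ik); ring.
  by case: (ltnP j k) => jk; rewrite /r; ring.
rewrite -big_mkcond/= -(big_mkord (fun j => (i <= j < k)%N) (fun=> r)).
have -> : \prod_(0 <= j < n | (i <= j < k)%N) r = \prod_(i <= j < k) r.
  rewrite (big_nat_widenl i 0)// (big_nat_widen 0 k n)//.
by rewrite prodr_const_nat.
Qed.

Lemma jump_weight_sum : \sum_b jump_weight b = 1.
Proof.
have := jump_sign_correlation (leqnn 0) (leq0n n); rewrite subnn expr0 => <-.
by apply: eq_bigr => b _; rewrite jump_sign0 !mulr1.
Qed.

Lemma jump_sign_mean k : (k <= n)%N ->
  \sum_b jump_weight b * jump_sign b k = r ^+ k.
Proof.
move=> kn; have := jump_sign_correlation (leq0n k) kn; rewrite subn0 => <-.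
by apply: eq_bigr => b _; rewrite jump_sign0 mul1r.
Qed.

(** The correlations decay geometrically, so the variance of the sum grows only
    linearly in n. *)
Lemma jump_sign_second_moment : 0 <= r -> r < 1 ->
  \sum_b jump_weight b * (\sum_(i < n) jump_sign b i) ^+ 2 <= n%:R * (2 / (1 - r)).
Proof.
move=> r0 r1; have r1' : 0 < 1 - r by rewrite subr_gt0.
have geo m : \sum_(i < m) r ^+ (m - i) <= r / (1 - r).
  elim: m => [|m IH]; first by rewrite big_ord0 divr_ge0// ltW.
  rewrite big_ord_recr/= subSnn.
  have -> : \sum_(i < m) r ^+ (m.+1 - i) = r * \sum_(i < m) r ^+ (m - i).
    by rewrite mulr_sumr; apply: eq_bigr => i _; rewrite subSn ?exprS// ltnW.
  apply: (@le_trans _ _ (r * (r / (1 - r)) + r)).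
    by rewrite lerD2r ler_wpM2l.
  rewrite le_eqVlt; apply/orP; left; apply/eqP; field; by rewrite gt_eqF.
suff H m : (m <= n)%N ->
    \sum_b jump_weight b * (\sum_(i < m) jump_sign b i) ^+ 2 <= m%:R * (2 / (1 - r)).
  exact: H.
elim: m => [|m IH] mn.
  by rewrite mul0r big1// => b _; rewrite big_ord0 expr0n mulr0.
have {}IH := IH (ltnW mn).
have -> : \sum_b jump_weight b * (\sum_(i < m.+1) jump_sign b i) ^+ 2 =
    \sum_b jump_weight b * (\sum_(i < m) jump_sign b i) ^+ 2 +
    (2 * \sum_(i < m) r ^+ (m - i) + 1).
  transitivity (\sum_b (jump_weight b * (\sum_(i < m) jump_sign b i) ^+ 2 +
      (2 * \sum_(i < m) jump_weight b * (jump_sign b i * jump_sign b m) + jump_weight b))).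
    apply: eq_bigr => b _; rewrite big_ord_recr/= sqrrD jump_sign_sqr.
    rewrite -mulr_natl !mulrDr mulr1 -addrA.
    congr (_ + (_ + _)); rewrite [LHS]mulrCA; congr (2 * _).
    by rewrite mulr_suml mulr_sumr.
  rewrite big_split/= big_split/= jump_weight_sum -mulr_sumr exchange_big/=.
  congr (_ + (2 * _ + _)); apply: eq_bigr => i _.
  by rewrite jump_sign_correlation// ltnW.
have := geo m; set g := \sum_(i < m) _; move=> gle.
have -> : m.+1%:R = m%:R + 1 :> R by rewrite natr1.
rewrite (mulrDl m%:R) mul1r; apply: lerD => //.
apply: (@le_trans _ _ (2 * (r / (1 - r)) + 1)); first by rewrite lerD2r ler_pM2l.
have -> : 2 * (r / (1 - r)) + 1 = (1 + r) / (1 - r) by field; rewrite gt_eqF.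
by rewrite ler_pM2r ?invr_gt0//; lra.
Qed.

(** If L varies slowly near A = 0, averaging it over the patterns nearly gives the
    mean of its values for the two final signs: the size of A is paid for by the
    second moment, the bias of the final sign by its mean r ^+ n. *)
Lemma jump_average_bound (L : R -> R -> R) (h eps C : R) :
  0 <= p <= 1 -> 0 <= r -> r < 1 -> 0 <= h -> 0 <= C ->
  (forall e A, 0 <= L e A <= 1) ->
  (forall e A, e ^+ 2 = 1 -> `|A| <= n%:R * h -> L e A <= L e 0 + eps + C * A ^+ 2) ->
  \sum_b jump_weight b * L (jump_sign b n) (h * \sum_(i < n) jump_sign b i) <=
  (L 1 0 + L (-1) 0) / 2 + eps + C * (h ^+ 2 * (n%:R * (2 / (1 - r)))) + r ^+ n.
Proof.
move=> p01 r0 r1 h0 C0 L01 Lle.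
pose x := (L 1 0 + L (-1) 0) / 2; pose y := (L 1 0 - L (-1) 0) / 2.
have y1 : y <= 1 by have := L01 1 0; have := L01 (-1) 0; rewrite /y; lra.
pose S b := \sum_(i < n) jump_sign b i.
have le1 b : jump_weight b * L (jump_sign b n) (h * S b) <=
    jump_weight b * (x + eps) + y * (jump_weight b * jump_sign b n) +
    C * h ^+ 2 * (jump_weight b * S b ^+ 2).
  have Sle : `|h * S b| <= n%:R * h.
    rewrite normrM ger0_norm// mulrC ler_wpM2r//.
    apply: le_trans (ler_norm_sum _ _ _) _.
    rewrite (_ : n%:R = \sum_(i < n) 1); last by rewrite sumr_const card_ord.
    apply: ler_sum => i _; have /eqP := jump_sign_sqr b i.
    by rewrite sqrf_eq1 => /orP[] /eqP ->; rewrite ?normrN normr1.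
  have := Lle _ _ (jump_sign_sqr b n) Sle => /(ler_wpM2l (jump_weight_ge0 b p01)).
  move=> /le_trans; apply; rewrite le_eqVlt; apply/orP; left; apply/eqP.
  have -> : L (jump_sign b n) 0 = x + y * jump_sign b n.
    have /eqP := jump_sign_sqr b n; rewrite sqrf_eq1 => /orP[] /eqP ->.
      by rewrite /x /y; field.
    by rewrite /x /y; field.
  by ring.
apply: le_trans (ler_sum _ (fun b _ => le1 b)) _.
rewrite !big_split/= -mulr_suml -!mulr_sumr jump_weight_sum mul1r jump_sign_mean//.
have := jump_sign_second_moment r0 r1; rewrite -/(S _).
set Q := \sum_b _; set Q' := _ * (2 / _); move=> QQ'.
have /(ler_wpM2l C0) : h ^+ 2 * Q <= h ^+ 2 * Q' by rewrite ler_wpM2l// sqr_ge0.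
have : y * r ^+ n <= r ^+ n by rewrite -[leRHS]mul1r ler_wpM2r// exprn_ge0.
rewrite -/x !mulrA; lra.
Qed.

End random_signs.

(** * The law of the discretized positions *)

Lemma measure_finType_bigcup d (T : measurableType d) (R : realType)
    (mu : {measure set T -> \bar R}) (I : finType) (F : I -> set T) :
  trivIset setT F -> (forall i, measurable (F i)) ->
  mu (\bigcup_i F i) = (\sum_i mu (F i))%E.
Proof.
move=> tF mF; have IE : [set: I] = [set` index_enum I].
  by apply/seteqP; split => i // _; exact: mem_index_enum.
rewrite measure_fin_bigcup//; last by rewrite IE; exact: finite_seq.
by rewrite IE -fsbig_seq//; exact: index_enum_uniq.
Qed.

Definition even_jumps (jb : nat -> bool) (i : nat) : bool :=
  ~~ odd (\sum_(j < i) jb j).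

(** Patterns indexed by all naturals compare directly with those read off a path. *)
Definition extend_false n (b : {ffun 'I_n -> bool}) (j : nat) : bool :=
  oapp b false (insub j).

Lemma extend_falseE n (b : {ffun 'I_n -> bool}) (j : 'I_n) :
  extend_false b j = b j.
Proof. by rewrite /extend_false valK. Qed.

Lemma jump_signE (R : realFieldType) n (b : {ffun 'I_n -> bool}) i : (i <= n)%N ->
  jump_sign R b i = if even_jumps (extend_false b) i then 1 else -1.
Proof.
move=> le_in; rewrite /even_jumps.
transitivity ((-1) ^+ (\sum_(j < i) extend_false b j) : R).
  rewrite -prodrXr /jump_sign (big_ord_widen _ (fun j => (-1) ^+ extend_false b j) le_in).
  by apply: eq_bigr => j _; rewrite extend_falseE.
by rewrite -signr_odd; case: odd; rewrite ?expr1 ?expr0.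
Qed.

Lemma select_sum_cstE (R : realType) (c : nat -> bool) (x y : R) (n : nat) :
  select_sum c (fun=> x) (fun=> y) n =
  n%:R * ((x + y) / 2) + (x - y) / 2 * \sum_(i < n) (if c i then 1 else -1).
Proof.
rewrite mulr_sumr /select_sum.
have -> : n%:R * ((x + y) / 2) = \sum_(i < n) ((x + y) / 2).
  by rewrite sumr_const card_ord mulr_natl.
by rewrite -big_split/=; apply: eq_bigr => i _; case: ifP => _; field.
Qed.

Section discretized_law.
Context d (T : measurableType d) (R : realType) (P : probability T R).
Variables (n : nat) (J : nat -> set T) (G1 G2 : nat -> T -> R) (p : R).
Variables (m1 s1 m2 s2 u0 v0 : R).
Hypotheses (mJ : forall i, measurable (J i)).
Hypotheses (mG1 : forall i, measurable_fun setT (G1 i)).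
Hypotheses (mG2 : forall i, measurable_fun setT (G2 i)).
Hypotheses (s1_ge0 : 0 <= s1) (s2_ge0 : 0 <= s2) (p01 : 0 <= p <= 1).

Definition jump_pattern (b : {ffun 'I_n -> bool}) : set T :=
  \bigcap_(i in [set: 'I_n]) (if b i then J i else ~` J i).

Hypothesis rule : forall (b : {ffun 'I_n -> bool}) (A B : nat -> set R),
  (forall i, measurable (A i)) -> (forall i, measurable (B i)) ->
  P (jump_pattern b `&` (\bigcap_(i < n) G1 i @^-1` A i `&`
                         \bigcap_(i < n) G2 i @^-1` B i)) =
  ((jump_weight p b)%:E * (\prod_(i < n) affine_normal m1 s1 (A i) *
                           \prod_(i < n) affine_normal m2 s2 (B i)))%E.

(** U and V follow the two particles; the coordinates list them in the order
    dictated by the parity of the number of jumps. *)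
Definition tracked_position (c : nat -> bool) (w : T) : R * R :=
  let U := u0 + select_sum c (G1 ^~ w) (G2 ^~ w) n in
  let V := v0 + select_sum (negb \o c) (G1 ^~ w) (G2 ^~ w) n in
  if c n then (U, V) else (V, U).

Definition discretized_position (w : T) : R * R :=
  tracked_position (even_jumps (fun j => `[< J j w >])) w.

Lemma measurable_jump_pattern b : measurable (jump_pattern b).
Proof.
apply: fin_bigcap_measurable => // i _; case: ifP => _ //.
exact: measurableC.
Qed.

Lemma jump_pattern_trivIset : trivIset setT jump_pattern.
Proof.
move=> b b' _ _ [w [wb wb']]; apply/ffunP => i.
have := wb i I; have := wb' i I; by case: (b i); case: (b' i).
Qed.

Lemma jump_pattern_cover w : exists b, jump_pattern b w.
Proof.
exists [ffun i : 'I_n => `[< J i w >]] => i _; rewrite ffunE.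
by case: ifPn => /asboolP.
Qed.

Lemma jump_pattern_even_jumps b w i : jump_pattern b w -> (i <= n)%N ->
  even_jumps (fun j => `[< J j w >]) i = even_jumps (extend_false b) i.
Proof.
move=> wb le_in; congr (~~ odd _); apply: eq_bigr => j _.
have jn : (j < n)%N by exact: leq_trans le_in.
rewrite (extend_falseE b (Ordinal jn)); congr nat_of_bool.
have := wb (Ordinal jn) I => /=.
by case: (b _) => /=; [move/asboolT|move/asboolF].
Qed.

Lemma eq_tracked_position c c' w :
  (forall i, (i <= n)%N -> c i = c' i) -> tracked_position c w = tracked_position c' w.
Proof.
move=> cc'; rewrite /tracked_position cc'//.
have E (f g : nat -> R) : select_sum c f g n = select_sum c' f g n.
  by apply: eq_bigr => i _; rewrite cc'// ltnW.
have E' (f g : nat -> R) : select_sum (negb \o c) f g n = select_sum (negb \o c') f g n.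
  by apply: eq_bigr => i _; rewrite /= cc'// ltnW.
by rewrite E E'.
Qed.

Lemma measurable_tracked_position c : measurable_fun setT (tracked_position c).
Proof.
rewrite /tracked_position; case: (c n); apply/measurable_fun_pairP; split;
  by apply: measurable_funD => //; exact: measurable_select_sum.
Qed.

Lemma discretized_positionE (O : set (R * R)) :
  discretized_position @^-1` O =
  \bigcup_b (jump_pattern b `&` tracked_position (even_jumps (extend_false b)) @^-1` O).
Proof.
have E b w : jump_pattern b w ->
    discretized_position w = tracked_position (even_jumps (extend_false b)) w.
  by move=> bw; apply: eq_tracked_position => i; exact: jump_pattern_even_jumps.
apply/seteqP; split => w.
  by have [b bw] := jump_pattern_cover w => Ow; exists b => //; split => //=; rewrite -E.
by move=> [b _ [bw] Ow] /=; rewrite (E b).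
Qed.

Lemma measurable_discretized_position : measurable_fun setT discretized_position.
Proof.
move=> _ O mO; rewrite setTI discretized_positionE.
apply: fin_bigcup_measurable => // b _; apply: measurableI.
  exact: measurable_jump_pattern.
by rewrite -[X in measurable X]setTI; exact: measurable_tracked_position.
Qed.

(** The law of a pair of independent normal variables whose means and variances
    deviate from (e a, - e a) and (1, 1) in opposite directions, in proportion to
    the difference A between the times spent in the two states. The sign e tells
    in which order the particles are listed. *)
Definition leaning_normal (a be ka e A : R) : set (R * R) -> \bar R :=
  (affine_normal (e * (a + be * A)) (Num.sqrt (1 + e * (ka * A))) \x
   affine_normal (- (e * (a + be * A))) (Num.sqrt (1 - e * (ka * A))))%E.

Variables (a be ka h : R).
Hypotheses (u0E : u0 + n%:R * ((m1 + m2) / 2) = a).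
Hypotheses (v0E : v0 + n%:R * ((m1 + m2) / 2) = - a).
Hypotheses (beE : (m1 - m2) / 2 = be * h).
Hypotheses (varE : n%:R * ((s1 ^+ 2 + s2 ^+ 2) / 2) = 1).
Hypotheses (kaE : (s1 ^+ 2 - s2 ^+ 2) / 2 = ka * h).

(** Given the pattern of jumps, the two particles are independent and normal, and
    their parameters depend on the pattern only through the sum of the signs. *)
Lemma discretized_law (O : set (R * R)) : measurable O ->
  P (discretized_position @^-1` O) =
  (\sum_(b : {ffun 'I_n -> bool}) (jump_weight p b)%:E *
     leaning_normal a be ka (jump_sign R b n)
       (h * \sum_(i < n) jump_sign R b i) O)%E.
Proof.
move=> mO; rewrite discretized_positionE measure_finType_bigcup; last 2 first.
- move=> b b' _ _ [w [[wb _] [wb' _]]].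
  by apply: jump_pattern_trivIset => //; exists w.
- move=> b; apply: measurableI; first exact: measurable_jump_pattern.
  by rewrite -[X in measurable X]setTI; exact: measurable_tracked_position.
apply: eq_bigr => b _; set c := even_jumps _.
pose U w := u0 + select_sum c (G1 ^~ w) (G2 ^~ w) n.
pose V w := v0 + select_sum (negb \o c) (G1 ^~ w) (G2 ^~ w) n.
have sgE i : (i <= n)%N -> jump_sign R b i = if c i then 1 else -1.
  exact: jump_signE.
pose S := \sum_(i < n) jump_sign R b i.
have SE : \sum_(i < n) (if c i then 1 else -1) = S.
  by apply: eq_bigr => i _; rewrite sgE// ltnW.
have SE' : \sum_(i < n) (if (negb \o c) i then 1 else -1) = - S.
  rewrite -sumrN; apply: eq_bigr => i _; rewrite sgE; last exact: ltnW.
  by change ((negb \o c) i) with (~~ c i); case: (c i); rewrite ?opprK.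
have mU : measurable_fun setT U.
  by apply: measurable_funD => //; exact: measurable_select_sum.
have mV : measurable_fun setT V.
  by apply: measurable_funD => //; exact: measurable_select_sum.
pose A := h * S.
have law B C : measurable B -> measurable C ->
    P (jump_pattern b `&` (U @^-1` B `&` V @^-1` C)) =
    ((jump_weight p b)%:E * (affine_normal (a + be * A) (Num.sqrt (1 + ka * A)) B *
       affine_normal (- (a + be * A)) (Num.sqrt (1 - ka * A)) C))%E.
  move=> mB mC; apply: etrans (select_sum_law c u0 v0 mG1 mG2 s1_ge0 s2_ge0
    (measurable_jump_pattern b) (jump_weight_ge0 b p01) (rule b) mB mC) _.
  rewrite !select_sum_cstE SE SE' !addrA u0E v0E beE varE kaE.
  by rewrite !mulrN -!mulrA -opprD.
have w0 := jump_weight_ge0 b p01.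
rewrite -/c /leaning_normal (sgE n)// -/S -/A /tracked_position.
case: (c n).
- rewrite !mul1r; exact: joint_law (measurable_jump_pattern b) mU mV w0 law _ mO.
- rewrite !mulN1r !opprK; apply: joint_law (measurable_jump_pattern b) mV mU w0 _ _ mO.
  by move=> B C mB mC; rewrite (setIC (V @^-1` B)) law// (muleC (affine_normal _ _ C)).
Qed.

End discretized_law.

(** * Perturbation of the normal laws *)

Section normal_convergence.
Context (R : realType).
Notation lambda := (@lebesgue_measure R).
Notation lambda2 := (@lebesgue_measure R \x @lebesgue_measure R)%E.

Definition product_normal_pdf (m s m' s' : R) (z : R * R) : R :=
  normal_pdf m s z.1 * normal_pdf m' s' z.2.

Lemma product_normal_pdf_ge0 m s m' s' z : 0 <= product_normal_pdf m s m' s' z.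
Proof. by rewrite mulr_ge0// normal_pdf_ge0. Qed.

Lemma measurable_product_normal_pdf m s m' s' :
  measurable_fun setT (product_normal_pdf m s m' s').
Proof.
apply: measurable_funM.
  exact: (measurableT_comp (measurable_normal_pdf m s) measurable_fst).
exact: (measurableT_comp (measurable_normal_pdf m' s') measurable_snd).
Qed.

Lemma integral_product_normal_pdf m s m' s' :
  (\int[lambda2]_z (product_normal_pdf m s m' s' z)%:E = 1)%E.
Proof.
rewrite -normal_product_density//.
have := probability_setT (normal_prob m s \x normal_prob m' s')%E.
exact.
Qed.

Lemma affine_normal_product_density m s m' s' (C : set (R * R)) :
  0 < s -> 0 < s' -> measurable C ->
  ((affine_normal m s \x affine_normal m' s') C =
   \int[lambda2]_(z in C) (product_normal_pdf m s m' s' z)%:E)%E.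
Proof.
move=> s0 s'0 mC; rewrite -(normal_product_density m s m' s' mC).
pose nu0 : {measure set (measurableTypeR R * measurableTypeR R) -> \bar R} :=
  (normal_prob m s \x normal_prob m' s')%E.
pose nu : {measure set (R * R) -> \bar R} := image_measure nu0 (@measurable_plane_id R).
have rect (A B : set R) : measurable A -> measurable B ->
    nu (A `*` B) = (affine_normal m s A * affine_normal m' s' B)%E.
  by move=> mA mB; rewrite -!normal_prob_affine// -product_measure1E.
exact: (product_measure_unique rect mC).
Qed.

Lemma cvg_normal_pdf (m_ s_ : nat -> R) (m s x : R) :
  (forall k, s_ k != 0) -> s != 0 ->
  m_ k @[k --> \oo] --> m -> s_ k @[k --> \oo] --> s ->
  normal_pdf (m_ k) (s_ k) x @[k --> \oo] --> normal_pdf m s x.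
Proof.
move=> s_0 s0 mm ss; rewrite normal_pdfE//.
under eq_cvg => k do rewrite normal_pdfE//.
have s2 : s_ k ^+ 2 @[k --> \oo] --> s ^+ 2 by apply: cvgM.
apply: cvgM.
  rewrite /normal_peak; apply: cvgV.
    by rewrite gt_eqF// sqrtr_gt0 mulrn_wgt0// mulr_gt0 ?pi_gt0// exprn_even_gt0.
  apply: (@continuous_cvg _ _ _ _ _ _ Num.sqrt); first exact: sqrt_continuous.
  rewrite -mulr_natr; under eq_cvg do rewrite -mulr_natr.
  by apply: cvgM; [apply: cvgM => //; exact: cvg_cst|exact: cvg_cst].
rewrite /normal_fun.
apply: (@continuous_cvg _ _ _ _ _ _ expR); first exact: continuous_expR.
apply: cvgM.
  apply: cvgN; apply: cvgM; apply: cvgB => //; exact: cvg_cst.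
apply: cvgV; first by rewrite mulrn_eq0/= expf_neq0.
rewrite -mulr_natr; under eq_cvg do rewrite -mulr_natr.
by apply: cvgM => //; exact: cvg_cst.
Qed.

Lemma cvg_product_normal_pdf (m_ s_ m'_ s'_ : nat -> R) (m s m' s' : R) :
  (forall k, s_ k != 0) -> s != 0 -> (forall k, s'_ k != 0) -> s' != 0 ->
  m_ k @[k --> \oo] --> m -> s_ k @[k --> \oo] --> s ->
  m'_ k @[k --> \oo] --> m' -> s'_ k @[k --> \oo] --> s' ->
  forall z, product_normal_pdf (m_ k) (s_ k) (m'_ k) (s'_ k) z @[k --> \oo] -->
    product_normal_pdf m s m' s' z.
Proof. by move=> *; apply: cvgM; exact: cvg_normal_pdf. Qed.

Definition leaning_pdf (a be ka e A : R) : R * R -> R :=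
  product_normal_pdf (e * (a + be * A)) (Num.sqrt (1 + e * (ka * A)))
    (- (e * (a + be * A))) (Num.sqrt (1 - e * (ka * A))).

(** By contradiction: a sequence of bad values of A tending to 0 would contradict
    Scheffe's lemma. *)
Lemma leaning_pdf_continuous (a be ka e eps : R) : 0 < eps ->
  exists2 del, 0 < del & forall A, `|A| <= del ->
   `|e * (ka * A)| < 1 /\
   (\int[lambda2]_z (`|leaning_pdf a be ka e A z - leaning_pdf a be ka e 0 z|)%:E
     <= eps%:E)%E.
Proof.
move=> eps0; set k := `|e * ka| + 1.
have k0 : 0 < k by rewrite ltr_wpDl.
(* The bound keeps |e ka A| at most 1/2, so that both variances stay positive. *)
pose del n : R := (2 * k)^-1 * harmonic n.
have del0 n : 0 < del n by rewrite mulr_gt0 ?invr_gt0 ?mulr_gt0// /harmonic /= invr_gt0.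
have smallA A n : `|A| <= del n -> `|e * (ka * A)| < 1.
  move=> Ale; rewrite mulrA normrM (@le_lt_trans _ _ (k * del n))//.
    by rewrite ler_pM// /k lerDl.
  rewrite /del invfM mulrA mulrCA mulfV ?gt_eqF// mulr1.
  have : harmonic n <= 1 :> R by rewrite /harmonic /= invf_le1// ler1n.
  lra.
apply: contrapT => /forall2NP nex.
have /choice [A_ HA] : forall n : nat, exists A, `|A| <= del n /\
    ~ (\int[lambda2]_z (`|leaning_pdf a be ka e A z - leaning_pdf a be ka e 0 z|)%:E
       <= eps%:E)%E.
  move=> n; have [//|] := nex (del n).
  move/existsNP => [A /not_implyP[Ale nA]]; exists A; split => // le.
  by apply: nA; split => //; exact: smallA Ale.
have del_cvg : del n @[n --> \oo] --> 0.
  by rewrite -(mulr0 (2 * k)^-1); apply: cvgM; [exact: cvg_cst|exact: cvg_harmonic].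
have A0 : A_ n @[n --> \oo] --> 0.
  apply/cvgr0Pnorm_le => x x0.
  move/cvgr0Pnorm_le : del_cvg => /(_ _ x0); apply: filterS => n.
  by rewrite (ger0_norm (ltW (del0 n))); apply: le_trans; have [] := HA n.
have ltA n : `|e * (ka * A_ n)| < 1 by apply: (smallA _ n); have [] := HA n.
have cm : e * (a + be * A_ n) @[n --> \oo] --> e * (a + be * 0).
  apply: cvgM; [exact: cvg_cst|apply: cvgD; first exact: cvg_cst].
  by apply: cvgM => //; exact: cvg_cst.
have ck : e * (ka * A_ n) @[n --> \oo] --> e * (ka * 0).
  by apply: cvgM; [exact: cvg_cst|apply: cvgM => //; exact: cvg_cst].
have sq0 (x : R) : `|x| < 1 -> Num.sqrt (1 + x) != 0 /\ Num.sqrt (1 - x) != 0.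
  by rewrite ltr_norml => /andP[? ?]; rewrite !gt_eqF ?sqrtr_gt0//; lra.
have [s0 s'0] : Num.sqrt (1 + e * (ka * 0)) != 0 /\ Num.sqrt (1 - e * (ka * 0)) != 0.
  by apply: sq0; rewrite !mulr0 normr0.
have cv : (\int[lambda2]_z (`|leaning_pdf a be ka e (A_ n) z -
      leaning_pdf a be ka e 0 z|)%:E
    @[n --> \oo] --> 0)%E.
  apply: scheffe => //.
  - by move=> n; exact: measurable_product_normal_pdf.
  - exact: measurable_product_normal_pdf.
  - by move=> n z; exact: product_normal_pdf_ge0.
  - by move=> z; exact: product_normal_pdf_ge0.
  - by move=> n; exact: integral_product_normal_pdf.
  - exact: integral_product_normal_pdf.
  - apply: cvg_product_normal_pdf => //.
    + by move=> n; have [] := sq0 _ (ltA n).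
    + by move=> n; have [] := sq0 _ (ltA n).
    + apply: (@continuous_cvg _ _ _ _ _ _ Num.sqrt); first exact: sqrt_continuous.
      by apply: cvgD => //; exact: cvg_cst.
    + exact: cvgN.
    + apply: (@continuous_cvg _ _ _ _ _ _ Num.sqrt); first exact: sqrt_continuous.
      by apply: cvgB => //; exact: cvg_cst.
have : (eps%:E <= 0)%E.
  rewrite -(cvg_lim _ cv)//; apply: lime_ge; first by apply/cvg_ex; exists 0%E.
  by apply: nearW => n; have [_ /negP] := HA n; rewrite -ltNge => /ltW.
by rewrite lee_fin leNgt eps0.
Qed.

Lemma leaning_normal_density (a be ka e A : R) (C : set (R * R)) :
  `|e * (ka * A)| < 1 -> measurable C ->
  (leaning_normal a be ka e A C =
   \int[lambda2]_(z in C) (leaning_pdf a be ka e A z)%:E)%E.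
Proof.
rewrite ltr_norml => /andP[? ?] mC.
by rewrite /leaning_normal affine_normal_product_density// sqrtr_gt0; lra.
Qed.

Lemma leaning_normal_fine (a be ka e A : R) (C : set (R * R)) : measurable C ->
  (leaning_normal a be ka e A C = (fine (leaning_normal a be ka e A C))%:E)%E /\
  0 <= fine (leaning_normal a be ka e A C) <= 1.
Proof.
move=> mC.
pose Q : probability (R * R)%type R :=
  (affine_normal (e * (a + be * A)) (Num.sqrt (1 + e * (ka * A))) \x
   affine_normal (- (e * (a + be * A))) (Num.sqrt (1 - e * (ka * A))))%E.
have Qfin : Q C \is a fin_num by exact: fin_num_measure.
have Q1 := probability_le1 Q mC.
have Q0 : (0 <= Q C)%E by exact: measure_ge0.
rewrite -[leaning_normal _ _ _ _ _ _]/(Q C) fineK//; split => //.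
by rewrite fine_ge0//= -lee_fin fineK.
Qed.

(** Small values of A cost eps by continuity; for the others C A^2 exceeds 1, as in
    Chebyshev's inequality. The constants do not depend on the event. *)
Lemma leaning_normal_perturbation (a be ka eps : R) : 0 < eps ->
  exists2 C, 0 <= C & forall (O : set (R * R)) e A, measurable O -> e ^+ 2 = 1 ->
    fine (leaning_normal a be ka e A O) <=
    fine (leaning_normal a be ka e 0 O) + eps + C * A ^+ 2.
Proof.
move=> eps0.
have arith (x y z : R) : 0 <= x -> y <= 1 -> 1 <= z -> y <= x + eps + z by lra.
have gen (X Y I1 I0 D : \bar R) (x y : R) : X = x%:E -> Y = y%:E ->
    X = I1 -> Y = I0 -> (I1 <= I0 + D)%E -> (D <= eps%:E)%E -> x <= y + eps.
  move=> Xx Yy XI YI le1 le2; rewrite -lee_fin EFinD -Xx -Yy XI YI.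
  exact: le_trans le1 (leeD2l _ le2).
have [d1 d10 H1] := leaning_pdf_continuous a be ka 1 eps0.
have [d2 d20 H2] := leaning_pdf_continuous a be ka (-1) eps0.
pose del := Num.min d1 d2.
have del0 : 0 < del by rewrite lt_min d10.
(* C = del^-2 makes C A^2 at least 1 as soon as |A| exceeds del. *)
exists (del ^- 2); first by rewrite invr_ge0 sqr_ge0.
move=> O e A mO e1.
have [E0 /andP[l0 _]] := leaning_normal_fine a be ka e 0 mO.
have [EA /andP[_ lA]] := leaning_normal_fine a be ka e A mO.
have [Ale|Agt] := leP `|A| del; last first.
  apply: arith => //.
  by rewrite mulrC ler_pdivlMr ?exprn_gt0// mul1r
    -(real_normK (num_real A)) ler_sqr ?nnegrE// ltW.
have [lt1 le] : `|e * (ka * A)| < 1 /\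
   (\int[lambda2]_z (`|leaning_pdf a be ka e A z - leaning_pdf a be ka e 0 z|)%:E
     <= eps%:E)%E.
  move: Ale; rewrite /del le_min => /andP[Ad1 Ad2].
  by move/eqP: e1; rewrite sqrf_eq1 => /orP[] /eqP ->; [exact: H1|exact: H2].
have C0 : 0 <= del ^- 2 * A ^+ 2 by rewrite mulr_ge0 ?invr_ge0 ?sqr_ge0.
rewrite -[leLHS]addr0; apply: lerD => //.
have lt0 : `|e * (ka * 0)| < 1 by rewrite !mulr0 normr0.
have mpdf A' : measurable_fun setT (leaning_pdf a be ka e A').
  exact: measurable_product_normal_pdf.
have pdf0 A' z : 0 <= leaning_pdf a be ka e A' z.
  exact: product_normal_pdf_ge0.
have D1 := leaning_normal_density a be lt1 mO.
have D0 := leaning_normal_density a be lt0 mO.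
have dist := integral_le_dist lambda2 (mpdf A) (mpdf 0) (pdf0 A) (pdf0 0) mO.
apply: gen EA E0 D1 D0 _ _; last exact: le.
exact: dist.
Qed.

End normal_convergence.

(** * Paths of counting processes *)

(** Heine's theorem, from the covering form of compactness. *)
Lemma within_continuous_unif (R : realType) (f : R -> R) (t eps : R) :
  0 < eps -> {within `[0, +oo[, continuous f} ->
  exists2 del, 0 < del & forall u v, 0 <= u <= t -> 0 <= v <= t ->
    `|u - v| <= del -> `|f u - f v| <= eps.
Proof.
move=> eps0 /subspace_continuousP cf.
have loc (x : R) : 0 <= x -> exists2 r, 0 < r & forall z, 0 <= z -> `|x - z| < r ->
    `|f x - f z| < eps / 2.
  move=> x0; have /cvgrPdist_lt/(_ _ (divr_gt0 eps0 (ltr0n _ 2))) :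
      f @ within `[0, +oo[ (nbhs x) --> f x.
    by apply: cf; rewrite /= in_itv/= x0.
  rewrite near_withinE => /nbhs_ballP[r /= r0 H]; exists r => // z z0 xz.
  by apply: H => //; rewrite /= in_itv/= z0.
have cpt : compact `[0, t] := @segment_compact R 0 t.
have H : \forall d \near (0 : R)^'+, `[0, t] `<=`
    (fun x => forall v, 0 <= x <= t -> 0 <= v <= t -> `|x - v| <= d -> `|f x - f v| <= eps).
  move/compact_near_coveringP : cpt; apply => x.
  rewrite /= in_itv/= => /andP[x0 xt]; have [r r0 H] := loc x x0.
  near=> y d => /= v /andP[y0 yt] /andP[v0 vt] yv.
  have xy : `|x - y| < r / 2.
    by near: y; apply: cvgr_dist_lt; rewrite ?divr_gt0.
  have dr : d <= r / 2.
    by near: d; apply: nbhs_right_le; rewrite divr_gt0.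
  have xv : `|x - v| < r.
    rewrite -(subrKA y) (le_lt_trans (ler_normD _ _))// [ltRHS]splitr ltr_leD//.
    exact: le_trans dr.
  have xyr : `|x - y| < r by apply: lt_trans xy _; rewrite ltr_pdivrMr// ltr_pMr// ltr1n.
  rewrite -(subrKA (f x)) (le_trans (ler_normD _ _))// [leRHS]splitr lerD//.
    by rewrite distrC ltW// H.
  by rewrite ltW// H.
have [d [d0 Hd]] := filter_ex (filterI (nbhs_right_gt (0 : R)) H).
exists d => // u v utt vtt uv.
by apply: (Hd u) => //; rewrite /= in_itv.
Unshelve. all: by end_near. Qed.

Section counting_path.
Context (R : realType) (N : R -> R).
Hypothesis N_nat : forall u, 0 <= u -> exists k : nat, N u = k%:R.
Hypothesis N_mono : forall u v, 0 <= u -> u <= v -> N u <= N v.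
Hypothesis N_right : forall u, 0 <= u -> N w @[w --> u^'+] --> N u.

Lemma count_lt u v : 0 <= u -> 0 <= v -> N u < N v -> N u + 1 <= N v.
Proof.
move=> u0 v0; have [k ->] := N_nat u0; have [l ->] := N_nat v0.
by rewrite ltr_nat natr1 ler_nat.
Qed.

Lemma left_limit_near (h g : R -> R) u v l : u < v ->
  (forall w, u <= w -> w < v -> h w = g w) -> g w @[w --> v^'-] --> l ->
  left_limit h v = l.
Proof.
move=> uv hg gl; apply: cvg_lim => //.
apply: cvg_trans gl; apply: near_eq_cvg.
near=> w; apply/esym/hg; near: w; [exact: nbhs_left_ge|exact: nbhs_left_lt].
Unshelve. all: by end_near. Qed.

Lemma left_limit_count u v : u < v ->
  (forall w, u <= w -> w < v -> N w = N u) -> left_limit N v = N u.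
Proof. by move=> uv H; apply: left_limit_near uv H _; exact: cvg_cst. Qed.

Definition count_jump v := N v - left_limit N v.

Lemma count_jump_flat u v w : 0 <= u -> N u = N v -> u < w -> w <= v ->
  count_jump w = 0.
Proof.
move=> u0 Nuv uw wv.
have flat z : u <= z -> z <= v -> N z = N u.
  move=> uz zv; apply/eqP; rewrite eq_le (N_mono u0 uz) andbT Nuv.
  by apply: N_mono => //; exact: le_trans uz.
rewrite /count_jump (left_limit_count uw) ?flat ?subrr// ?(ltW uw)//.
by move=> z uz zw; apply: flat => //; exact: le_trans (ltW zw) wv.
Qed.

(** A counting path takes distinct values at distinct jump times, and finitely many
    values up to time t. *)
Lemma finite_count_jumps t : finite_set [set v | 0 < v <= t /\ count_jump v != 0].
Proof.
have [t0|t0] := ltP t 0.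
  apply: (sub_finite_set _ (finite_set0 R)) => v [/andP[v0 vt] _].
  by have := lt_le_trans v0 vt; rewrite ltNge ltW.
have [kt Nt] := N_nat t0.
set J := [set v | _].
have injN u v : J u -> J v -> N u = N v -> u <= v.
  move=> [/andP[u0 ut] ju] [/andP[v0 vt] jv] Nuv; rewrite leNgt; apply/negP => vu.
  by move/eqP: ju; apply; apply: (count_jump_flat (ltW v0) (esym Nuv)).
(* The jump time at which the path reaches k, when there is one. *)
pose g (k : nat) : R := xget 0 [set v | J v /\ N v = k%:R].
apply: (sub_finite_set _ (finite_image g (finite_II kt.+1))) => v Jv.
have [/andP[v0 vt] _] := Jv; have [k Nk] := N_nat (ltW v0).
exists k.
  by rewrite /= ltnS -(ler_nat R) -Nk -Nt; apply: N_mono => //; exact: ltW.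
have [Jg Ng] : [set v | J v /\ N v = k%:R] (g k) by apply: xgetPex; exists v.
by apply/eqP; rewrite eq_le !injN// Ng Nk.
Qed.

Let J t := [set v | 0 < v <= t /\ count_jump v != 0].

Lemma jump_integral_support h t :
  jump_integral h N t = \sum_(v \in J t) left_limit h v * count_jump v.
Proof.
rewrite /jump_integral; apply/esym/fsbig_widen.
  by move=> v [/andP[v0 vt] _]; rewrite /= in_itv/= v0.
move=> v [/=]; rewrite in_itv/= => v0t nJ.
rewrite -/(count_jump v); have [->|jv] := eqVneq (count_jump v) 0; first by rewrite mulr0.
by exfalso; apply: nJ.
Qed.

(** The path is constant on [u, v[, so v is the only possible jump time in ]u, v].
    If there is no jump at v, the added term vanishes. *)
Lemma jump_integral_step h u v : 0 <= u -> u < v ->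
  (forall w, u <= w -> w < v -> N w = N u) ->
  jump_integral h N v = jump_integral h N u + left_limit h v * (N v - N u).
Proof.
move=> u0 uv flat.
have -> : N v - N u = count_jump v by rewrite /count_jump (left_limit_count uv flat).
have <- : \sum_(w \in [set v]) left_limit h w * count_jump w =
    left_limit h v * count_jump v.
  by rewrite fsbig_set1.
rewrite !jump_integral_support -fsbigU0//; last 2 first.
- exact: finite_count_jumps.
- by move=> w [[/andP[_ wu] _] wv]; move: wu; rewrite wv leNgt uv.
apply: fsbig_widen.
  move=> w [/andP[w0 wv] jw].
  move: wv; rewrite le_eqVlt => /predU1P[->|wv]; first by right.
  left; split => //; rewrite w0/= leNgt; apply/negP => uw.
  by move/eqP: jw; apply; apply: (count_jump_flat u0 (esym (flat w (ltW uw) wv))).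
move=> w [[|]] /=.
  move=> [/andP[w0 wu] jw] nJ; exfalso; apply: nJ; split => //.
  by rewrite w0/= (le_trans wu (ltW uv)).
move=> -> nJ; have [->|jv] := eqVneq (count_jump v) 0; first by rewrite mulr0.
by exfalso; apply: nJ; split => //; rewrite lexx andbT (le_lt_trans u0 uv).
Qed.

Lemma jump_integral_flat h u v : 0 <= u -> u <= v -> N u = N v ->
  jump_integral h N v = jump_integral h N u.
Proof.
move=> u0; rewrite le_eqVlt => /predU1P[->//|uv] Nuv.
have flat w : u <= w -> w < v -> N w = N u.
  move=> uw wv; apply/eqP; rewrite eq_le (N_mono u0 uw) andbT Nuv.
  by apply: N_mono; [exact: le_trans uw|exact: ltW].
by rewrite (jump_integral_step h u0 uv flat) Nuv subrr mulr0 addr0.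
Qed.

(** The jump time is the infimum of the times at which the path has reached its
    final value; right continuity makes it attained. *)
Lemma count_jump_time u v : 0 <= u -> u <= v -> N u < N v ->
  exists w, [/\ u < w, w <= v, (forall z, u <= z -> z < w -> N z < N v) & N w = N v].
Proof.
move=> u0 uv Nuv; pose S := [set z | u <= z /\ N v <= N z].
have Sv : S v by [].
have hS : has_inf S by split; [exists v|exists u => z []].
pose w := inf S.
have uw : u <= w by apply: lb_le_inf; [exists v|move=> z []].
have wv : w <= v by apply: ge_inf => //; case: hS.
have before z : u <= z -> z < w -> N z < N v.
  move=> uz zw; rewrite ltNge; apply/negP => Nvz.
  have : w <= z by apply: ge_inf => //; case: hS.
  by rewrite leNgt zw.
have w0 : 0 <= w by exact: le_trans uw.
have Nw : N w = N v.
  apply/eqP; rewrite eq_le N_mono//= leNgt; apply/negP => Nwv.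
  have : \forall z \near w^'+, N z < N v.
    by have /cvgr_lt := N_right w0; apply.
  rewrite near_withinE => /nbhs_ballP[r /= r0 H].
  have [z Sz zw] := inf_adherent r0 hS.
  have wz : w <= z by apply: ge_inf => //; case: hS.
  have wz' : w < z.
    rewrite lt_neqAle wz andbT; apply/eqP => wz'; case: Sz => _.
    by rewrite -wz' leNgt Nwv.
  have : N z < N v by apply: H => //; rewrite /ball/= distrC ger0_norm ?subr_ge0// ltrBlDl.
  by case: Sz => _; rewrite leNgt => /negP.
exists w; split => //; rewrite lt_neqAle uw andbT; apply/eqP => uw'.
by move: Nuv; rewrite uw' Nw ltxx.
Qed.

End counting_path.

(** * Convergence of the discretized paths *)

Lemma even_jumpsS jb i :
  even_jumps jb i.+1 = if jb i then ~~ even_jumps jb i else even_jumps jb i.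
Proof.
by rewrite /even_jumps big_ord_recr/= oddD; case: (jb i); case: odd.
Qed.

Section swapping_path.
Context (R : realType) (N a b X Y : R -> R) (x0 y0 : R).
Hypothesis N_nat : forall u, 0 <= u -> exists k : nat, N u = k%:R.
Hypothesis N_mono : forall u v, 0 <= u -> u <= v -> N u <= N v.
Hypothesis N_right : forall u, 0 <= u -> N w @[w --> u^'+] --> N u.
Hypothesis N0 : N 0 = 0.
Hypotheses (ca : {within `[0, +oo[, continuous a}) (cb : {within `[0, +oo[, continuous b}).
Hypotheses (a0 : a 0 = 0) (b0 : b 0 = 0).
Hypothesis X_eq : forall u, 0 <= u ->
  X u = x0 + a u + jump_integral (fun v => Y v - X v) N u.
Hypothesis Y_eq : forall u, 0 <= u ->
  Y u = y0 + b u + jump_integral (fun v => X v - Y v) N u.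

Lemma flat_step p q : 0 <= p -> p <= q -> N p = N q ->
  X q = X p + (a q - a p) /\ Y q = Y p + (b q - b p).
Proof.
move=> p0 pq Npq; have q0 := le_trans p0 pq.
rewrite (X_eq p0) (X_eq q0) (Y_eq p0) (Y_eq q0).
by rewrite !(jump_integral_flat N_nat N_mono _ p0 pq Npq); split; ring.
Qed.

Let cvg_left (f : R -> R) v : {within `[0, +oo[, continuous f} -> 0 < v ->
  f w @[w --> v^'-] --> f v.
Proof.
move=> cf v0; apply/cvgrPdist_le => e e0.
have [del del0 H] := within_continuous_unif v e0 cf.
near=> w.
have w0 : 0 <= w by near: w; exact: nbhs_left_ge.
have wv : w <= v by near: w; exact: nbhs_left_le.
apply: H; rewrite ?lexx ?w0 ?wv ?(ltW v0)//.
rewrite ger0_norm ?subr_ge0//; apply/ltW.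
by near: w; exact: nbhs_left_ltBl.
Unshelve. all: by end_near. Qed.

(** At the jump time v the two left limits are exchanged: afterwards each
    coordinate continues from the place of the other one. *)
Lemma jump_step p q : 0 <= p -> p <= q -> N q = N p + 1 ->
  exists v, [/\ p < v, v <= q,
    X q = Y p + (b v - b p) + (a q - a v) &
    Y q = X p + (a v - a p) + (b q - b v)].
Proof.
move=> p0 pq Npq.
have Nlt : N p < N q by rewrite Npq ltrDl.
have [v [pv vq before Nv]] := count_jump_time N_mono N_right p0 pq Nlt.
have v0 : 0 < v by exact: le_lt_trans pv.
have flat w : p <= w -> w < v -> N w = N p.
  move=> pw wv; apply/eqP; rewrite eq_le (N_mono p0 pw) andbT.
  have w0 := le_trans p0 pw; have q0 := le_trans p0 pq.
  by have := count_lt N_nat w0 q0 (before w pw wv); rewrite Npq lerD2r.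
have steps w : p <= w -> w < v -> X w = X p + (a w - a p) /\ Y w = Y p + (b w - b p).
  by move=> pw wv; apply: flat_step => //; rewrite flat.
have llYX : left_limit (fun w => Y w - X w) v =
    (Y p + (b v - b p)) - (X p + (a v - a p)).
  apply: (left_limit_near (g := fun w => (Y p + (b w - b p)) - (X p + (a w - a p))) pv).
    by move=> w pw wv; have [-> ->] := steps w pw wv.
  by apply: cvgB; apply: cvgD; [exact: cvg_cst|
    apply: cvgB; [exact: cvg_left|exact: cvg_cst]|
     exact: cvg_cst|apply: cvgB; [exact: cvg_left|exact: cvg_cst]].
have llXY : left_limit (fun w => X w - Y w) v =
    (X p + (a v - a p)) - (Y p + (b v - b p)).
  apply: (left_limit_near (g := fun w => (X p + (a w - a p)) - (Y p + (b w - b p))) pv).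
    by move=> w pw wv; have [-> ->] := steps w pw wv.
  by apply: cvgB; apply: cvgD; [exact: cvg_cst|
    apply: cvgB; [exact: cvg_left|exact: cvg_cst]|
     exact: cvg_cst|apply: cvgB; [exact: cvg_left|exact: cvg_cst]].
have [Xq Yq] := flat_step (ltW v0) vq Nv.
have one : N v - N p = 1 by rewrite Nv Npq addrAC subrr add0r.
have Xv : X v = Y p + (b v - b p).
  rewrite (X_eq (ltW v0)) (jump_integral_step N_nat N_mono _ p0 pv flat) llYX one mulr1.
  by have := X_eq p0; set I := jump_integral _ _ _ => ->; ring.
have Yv : Y v = X p + (a v - a p).
  rewrite (Y_eq (ltW v0)) (jump_integral_step N_nat N_mono _ p0 pv flat) llXY one mulr1.
  by have := Y_eq p0; set I := jump_integral _ _ _ => ->; ring.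
by exists v; split => //; rewrite ?Xq ?Yq ?Xv ?Yv.
Qed.

Section mesh.
Variables (t omega : R) (n : nat).
Hypotheses (t0 : 0 <= t) (n0 : (0 < n)%N) (omega0 : 0 <= omega).
Hypothesis oscillation : forall u v, 0 <= u <= t -> 0 <= v <= t -> `|u - v| <= t / n%:R ->
  `|a u - a v| <= omega /\ `|b u - b v| <= omega.

Let tau (i : nat) : R := i%:R * (t / n%:R).

Hypothesis sparse : forall i, (i < n)%N ->
  N (tau i.+1) = N (tau i) \/ N (tau i.+1) = N (tau i) + 1.

Let jb i := N (tau i.+1) != N (tau i).
Let c := even_jumps jb.
Let da i := a (tau i.+1) - a (tau i).
Let db i := b (tau i.+1) - b (tau i).

Let h0 : 0 <= t / n%:R. Proof. by rewrite divr_ge0. Qed.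

Let tau_le i : tau i <= tau i.+1.
Proof. by rewrite ler_wpM2r// ler_nat. Qed.

Let tau_ge0 i : 0 <= tau i. Proof. by rewrite mulr_ge0. Qed.

Let tau_leT i : (i <= n)%N -> tau i <= t.
Proof.
move=> le_in; rewrite /tau mulrCA ler_piMr// ler_pdivrMr ?ltr0n// mul1r ler_nat//.
Qed.

(** On an interval without jump the discretization is exact. On an interval with
    one jump, only the increments after the jump go to the wrong particle, an error
    of at most two oscillations. The number of such intervals up to i is the value
    of the counting path. *)
Lemma mesh_error i : (i <= n)%N ->
  `|(if c i then X (tau i) else Y (tau i)) - (x0 + select_sum c da db i)|
     <= 2 * omega * N (tau i) /\
  `|(if c i then Y (tau i) else X (tau i)) - (y0 + select_sum (negb \o c) da db i)|
     <= 2 * omega * N (tau i).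
Proof.
elim: i => [|i IH] le_in.
  have J0 h : jump_integral h N 0 = 0.
    by rewrite /jump_integral set_itv_ge ?fsbig_set0// bnd_simp ltxx.
  rewrite /c /even_jumps big_ord0/= /tau mul0r N0 mulr0 /select_sum !big_ord0.
  by rewrite X_eq// Y_eq// !J0 a0 b0 !addr0 !subrr normr0.
have [IH1 IH2] := IH (ltnW le_in).
have tri (x y z w e : R) : `|x - y| <= e -> `|z - w| <= 2 * omega ->
    `|x + z - (y + w)| <= e + 2 * omega.
  move=> xy zw; rewrite opprD addrACA (le_trans (ler_normD _ _))// lerD//.
rewrite !select_sumS !addrA.
case: (sparse le_in) => Ni.
- have [EX EY] := flat_step (tau_ge0 i) (tau_le i) (esym Ni).
  have cS : c i.+1 = c i by rewrite /c even_jumpsS /jb Ni eqxx.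
  rewrite cS Ni EX EY /=.
  have add0 (x y z : R) : x + z - (y + z) = x - y by rewrite opprD addrACA subrr addr0.
  by move: IH1 IH2; case: (c i) => /=; rewrite !add0.
have [v [pv vq EX EY]] := jump_step (tau_ge0 i) (tau_le i) Ni.
have cS : c i.+1 = ~~ c i.
  rewrite /c even_jumpsS /jb Ni; case: eqP => // /eqP.
  by rewrite -subr_eq0 addrAC subrr add0r oner_eq0.
have v01 : 0 <= v <= t by rewrite (le_trans (tau_ge0 i) (ltW pv)) (le_trans vq)// tau_leT.
have q01 : 0 <= tau i.+1 <= t by rewrite tau_ge0 tau_leT.
have close : `|tau i.+1 - v| <= t / n%:R.
  rewrite ger0_norm ?subr_ge0// lerBlDr.
  have -> : tau i.+1 = t / n%:R + tau i by rewrite /tau -natr1 mulrDl mul1r addrC.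
  by rewrite lerD2l ltW.
have [oa ob] := oscillation q01 v01 close.
have dev (x y z : R) : `|x| <= omega -> `|y| <= omega -> z = x - y -> `|z| <= 2 * omega.
  move=> xo yo ->; rewrite (le_trans (ler_normB _ _))// mulr_natl mulr2n lerD//.
rewrite cS Ni mulrDr mulr1 EX EY -(addrA (X (tau i))) -(addrA (Y (tau i))).
have d1 : `|a v - a (tau i) + (b (tau i.+1) - b v) - da i| <= 2 * omega.
  by apply: (dev (b (tau i.+1) - b v) (a (tau i.+1) - a v)) => //; rewrite /da; ring.
have d2 : `|b v - b (tau i) + (a (tau i.+1) - a v) - db i| <= 2 * omega.
  by apply: (dev (a (tau i.+1) - a v) (b (tau i.+1) - b v)) => //; rewrite /db; ring.
by rewrite /=; move: IH1 IH2; case: (c i) => /= IH1 IH2; split; apply: tri.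
Qed.

End mesh.

Variables (t : R) (m_ : nat -> nat).
Hypotheses (t0 : 0 < t) (m_gt0 : forall k, (0 < m_ k)%N).
Hypothesis m_cvg : (m_ k)%:R^-1 @[k --> \oo] --> (0 : R).
Let tau k (i : nat) : R := i%:R * (t / (m_ k)%:R).
Hypothesis eventually_sparse : \forall k \near \oo, forall i, (i < m_ k)%N ->
  N (tau k i.+1) = N (tau k i) \/ N (tau k i.+1) = N (tau k i) + 1.
Let c k := even_jumps (fun i => N (tau k i.+1) != N (tau k i)).
Let da k i := a (tau k i.+1) - a (tau k i).
Let db k i := b (tau k i.+1) - b (tau k i).

(** The error bound is the oscillation of the drivers over one mesh interval times
    the number of jumps of the path, which is finite. *)
Lemma mesh_cvg :
  (let U := x0 + select_sum (c k) (da k) (db k) (m_ k) in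
   let V := y0 + select_sum (negb \o c k) (da k) (db k) (m_ k) in
   if c k (m_ k) then (U, V) else (V, U)) @[k --> \oo] --> (X t, Y t).
Proof.
pose U k := x0 + select_sum (c k) (da k) (db k) (m_ k).
pose V k := y0 + select_sum (negb \o c k) (da k) (db k) (m_ k).
have tauT k : tau k (m_ k) = t.
  by rewrite /tau mulrCA divff ?mulr1// pnatr_eq0 -lt0n.
have Nt0 : 0 <= N t by rewrite -N0; apply: N_mono => //; exact: ltW.
have bound e : 0 < e -> \forall k \near \oo,
    `|X t - (if c k (m_ k) then U k else V k)| <= e /\
    `|Y t - (if c k (m_ k) then V k else U k)| <= e.
  (* The total error is at most 2 om N t, and N t + 1 avoids a division by 0. *)
  move=> e0; pose om := e / (2 * (N t + 1)).
  have om0 : 0 < om by rewrite divr_gt0 ?mulr_gt0 ?ltr_wpDl.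
  have omN : 2 * om * N t <= e.
    have -> : 2 * om * N t = e * (N t / (N t + 1)).
      by rewrite /om; field; rewrite gt_eqF// ltr_wpDl.
    by rewrite ler_piMr ?(ltW e0)// ler_pdivrMr ?ltr_wpDl// mul1r lerDl.
  have [d1 d10 H1] := within_continuous_unif t om0 ca.
  have [d2 d20 H2] := within_continuous_unif t om0 cb.
  have mesh0 : t / (m_ k)%:R @[k --> \oo] --> 0.
    by rewrite -(mulr0 t); apply: cvgM => //; exact: cvg_cst.
  have d0 : 0 < Num.min d1 d2 by rewrite lt_min d10.
  move/cvgr0Pnorm_le : mesh0 => /(_ _ d0) mesh0.
  near=> k.
  have small : t / (m_ k)%:R <= Num.min d1 d2.
    by rewrite (le_trans (ler_norm _))//; near: k.
  have sp : forall i, (i < m_ k)%N ->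
    N (tau k i.+1) = N (tau k i) \/ N (tau k i.+1) = N (tau k i) + 1 by near: k.
  have osc u v : 0 <= u <= t -> 0 <= v <= t -> `|u - v| <= t / (m_ k)%:R ->
      `|a u - a v| <= om /\ `|b u - b v| <= om.
    move=> ut vt uv; have := le_trans uv small; rewrite le_min => /andP[? ?].
    by split; [exact: H1|exact: H2].
  have [] := mesh_error (ltW t0) (m_gt0 k) osc sp (leqnn (m_ k)).
  rewrite -/(c k) -/(da k) -/(db k) -/(tau k _) tauT -/(U k) -/(V k).
  by case: (c k (m_ k)) => B1 B2; split; exact: le_trans omN.
have -> : (fun k => let U0 := U k in let V0 := V k in
    if c k (m_ k) then (U0, V0) else (V0, U0)) =
  (fun k => (if c k (m_ k) then U k else V k, if c k (m_ k) then V k else U k)).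
  by apply/funext => k /=; case: (c k (m_ k)).
have cX : (if c k (m_ k) then U k else V k) @[k --> \oo] --> X t.
  by apply/cvgrPdist_le => e /bound; apply: filterS => k [].
have cY : (if c k (m_ k) then V k else U k) @[k --> \oo] --> Y t.
  by apply/cvgrPdist_le => e /bound; apply: filterS => k [].
exact: (cvg_pair cX cY).
Unshelve. all: by end_near. Qed.

End swapping_path.

(** * Increments of the driving processes on a mesh *)

Section increments.
Context (R : realType) d (T : measurableType d) (P : probability T R).
Implicit Type Z : R -> {RV P >-> R}.

Lemma measurable_increment Z u v : measurable_fun setT (increment Z u v).
Proof. by apply: measurable_funB. Qed.

Lemma sigma_of_process_increment Z u v (A : set R) : 0 <= u -> 0 <= v ->
  measurable A -> sigma_of_process Z (increment Z u v @^-1` A).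
Proof.
move=> u0 v0 mA.
pose G := \bigcup_(t in `[0, +oo[) preimage_set_system setT (Z t : T -> R) measurable.
have mZ w : 0 <= w -> measurable_fun setT (Z w : g_sigma_algebraType G -> R).
  move=> w0 _ B mB; apply: sub_sigma_algebra; exists w; first by rewrite /= in_itv/= w0.
  by exists B.
have mI : measurable_fun setT (fun w : g_sigma_algebraType G => Z v w - Z u w).
  by apply: measurable_funB; exact: mZ.
by have := mI measurableT _ mA; rewrite setTI.
Qed.

Lemma sigma_of_process_bigcap Z n (F : nat -> set T) :
  (forall i, sigma_of_process Z (F i)) -> sigma_of_process Z (\bigcap_(i < n) F i).
Proof.
move=> mF.
pose G := \bigcup_(t in `[0, +oo[) preimage_set_system setT (Z t : T -> R) measurable.
have : @measurable _ (g_sigma_algebraType G) (\bigcap_(i < n) F i).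
  by apply: fin_bigcap_measurable => // i _; exact: mF.
by [].
Qed.

End increments.

(** The probability of two or more events is at most the square of the rate, because
    exp (- lam) (1 + lam) >= (1 - lam) (1 + lam). *)
Lemma poisson_pmf_small (R : realType) (lam : R) : 0 < lam ->
  1 - (poisson_pmf lam 0 + poisson_pmf lam 1) <= lam ^+ 2.
Proof.
move=> lam0; rewrite /poisson_pmf lam0 expr0 expr1 !fact0 !invr1 mul1r !mulr1 mul1r.
have := expR_ge1Dx (- lam); set E := expR _ => H.
have : (1 - lam) * (1 + lam) <= E * (1 + lam).
  by rewrite ler_wpM2r// addr_ge0// ltW.
lra.
Qed.

Section mesh_laws.
Context (R : realType) d (T : measurableType d) (P : probability T R).
Variables (t s : R) (n : nat).
Hypotheses (t0 : 0 < t) (s0 : 0 < s) (n0 : (0 < n)%N).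
Local Notation h := (t / n%:R).

Definition mesh (i : nat) : R := i%:R * (t / n%:R).

Lemma mesh_step : 0 < h. Proof. by rewrite divr_gt0// ltr0n. Qed.

Lemma mesh_ge0 i : 0 <= mesh i. Proof. by rewrite mulr_ge0// ltW// mesh_step. Qed.

Lemma mesh_homo : {homo mesh : i j / (i <= j)%N >-> i <= j}.
Proof. by move=> i j ij; rewrite ler_wpM2r ?ler_nat// ltW// mesh_step. Qed.

Lemma mesh_subS i : mesh i.+1 - mesh i = h.
Proof. by rewrite /mesh -natr1 mulrDl mul1r addrC addrA addNr add0r. Qed.

Lemma mesh_ltS i : mesh i < mesh i.+1.
Proof. by rewrite -subr_gt0 mesh_subS mesh_step. Qed.

Lemma brownian_increment_affine (W : R -> {RV P >-> R}) i (k m : R) (A : set R) :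
  brownian_motion W -> measurable A ->
  P (increment W (mesh i) (mesh i.+1) @^-1` ((fun x => m + k * x) @^-1` A)) =
  affine_normal m (k * Num.sqrt h) A.
Proof.
move=> bW mA.
have mpre : measurable ((fun x => m + k * x) @^-1` A).
  rewrite -[X in measurable X]setTI.
  have : measurable_fun setT (fun x => m + k * x).
    by apply: measurable_funD => //; apply: measurable_funM.
  exact.
rewrite (bm_law bW (mesh_ge0 i) (mesh_ltS i) mpre) mesh_subS.
rewrite normal_prob_affine ?sqrtr_gt0 ?mesh_step// /affine_normal.
by congr normal_prob; apply/seteqP; split => z /=; rewrite add0r mulrA.
Qed.

Variable (N : R -> {RV P >-> R}).
Hypothesis NP : poisson_process s N.
Let dN i := increment N (mesh i) (mesh i.+1).

Definition jump_event (i : nat) : set T := dN i @^-1` (~` [set 0]).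

Lemma measurable_jump_event i : measurable (jump_event i).
Proof.
rewrite -[jump_event i]setTI; apply: measurable_increment => //.
exact: measurableC.
Qed.

Definition jump_probability : R := 1 - expR (- (s * h)).

Lemma jump_probability01 : 0 <= jump_probability <= 1.
Proof.
rewrite subr_ge0 lerBlDr lerDl expR_ge0 andbT -[leRHS]expR0 ler_expR oppr_le0.
by rewrite mulr_ge0 ?ltW// mesh_step.
Qed.

Lemma no_jump_probability i : P (~` jump_event i) = (expR (- (s * h)))%:E.
Proof.
rewrite /jump_event preimage_setC setCK.
have := pp_law NP (mesh_ge0 i) (mesh_ltS i) 0%N; rewrite mesh_subS => ->.
by rewrite /poisson_pmf mulr_gt0 ?mesh_step// expr0 fact0 invr1 !mul1r.
Qed.

Lemma jump_pattern_probability (b : {ffun 'I_n -> bool}) :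
  P (jump_pattern jump_event b) = (jump_weight jump_probability b)%:E /\
  sigma_of_process N (jump_pattern jump_event b).
Proof.
pose B i : set R := if extend_false b i then ~` [set 0] else [set 0].
have mB i : measurable (B i) by rewrite /B; case: ifP => _ //; exact: measurableC.
have E : jump_pattern jump_event b = \bigcap_(i < n) (dN i @^-1` B i).
  apply/seteqP; split => w H i.
    move=> /= ilt; have := H (Ordinal ilt) I; rewrite /B.
    rewrite (_ : extend_false b i = b (Ordinal ilt)); last first.
      exact: (extend_falseE b (Ordinal ilt)).
    by case: (b _) => //; rewrite /jump_event preimage_setC setCK.
  move=> _; have := H i (ltn_ord i); rewrite /B extend_falseE.
  by case: (b i) => //; rewrite /jump_event preimage_setC setCK.
rewrite E; split; last first.
  apply: sigma_of_process_bigcap => i.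
  by apply: sigma_of_process_increment; rewrite ?mesh_ge0.
rewrite (pp_indep NP)//; last 2 first.
- exact: mesh_ge0.
- exact: mesh_homo.
rewrite /jump_weight -prodEFin; apply: eq_bigr => i _; rewrite /B extend_falseE.
have nj := no_jump_probability i.
case: (b i).
- have := probability_setC P (measurable_jump_event i).
  have -> : P (jump_event i) = (1 - P (~` jump_event i))%E.
    by rewrite -[in LHS](setCK (jump_event i)) probability_setC//;
      exact: measurableC (measurable_jump_event i).
  by rewrite nj.
- rewrite /jump_probability subKr -nj; congr (P _).
  by rewrite /jump_event preimage_setC setCK.
Qed.

Variables (W1 W2 : R -> {RV P >-> R}) (k1 m1 k2 m2 : R).
Hypotheses (bW1 : brownian_motion W1) (bW2 : brownian_motion W2).
Hypothesis ind : independent3 P (sigma_of_process W1) (sigma_of_process W2)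
    (sigma_of_process N).

(** The three processes are independent, and each has independent increments. *)
Lemma mesh_product_rule (b : {ffun 'I_n -> bool}) (A B : nat -> set R) :
  (forall i, measurable (A i)) -> (forall i, measurable (B i)) ->
  P (jump_pattern jump_event b `&`
     (\bigcap_(i < n) (fun w => m1 + k1 * increment W1 (mesh i) (mesh i.+1) w) @^-1` A i `&`
      \bigcap_(i < n) (fun w => m2 + k2 * increment W2 (mesh i) (mesh i.+1) w) @^-1` B i)) =
  ((jump_weight jump_probability b)%:E *
     (\prod_(i < n) affine_normal m1 (k1 * Num.sqrt h) (A i) *
      \prod_(i < n) affine_normal m2 (k2 * Num.sqrt h) (B i)))%E.
Proof.
move=> mA mB; have [Pb sb] := jump_pattern_probability b.
have mpre k m (C : set R) : measurable C -> measurable ((fun x => m + k * x) @^-1` C).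
  move=> mC; rewrite -[X in measurable X]setTI.
  have : measurable_fun setT (fun x : R => m + k * x).
    by apply: measurable_funD => //; apply: measurable_funM.
  exact.
pose A' i := (fun x => m1 + k1 * x) @^-1` A i.
pose B' i := (fun x => m2 + k2 * x) @^-1` B i.
rewrite setIC ind//; last 2 first.
- apply: (@sigma_of_process_bigcap _ _ _ _ W1 n
    (fun i => increment W1 (mesh i) (mesh i.+1) @^-1` A' i)) => i.
  by apply: sigma_of_process_increment; rewrite ?mesh_ge0//; exact: mpre.
- apply: (@sigma_of_process_bigcap _ _ _ _ W2 n
    (fun i => increment W2 (mesh i) (mesh i.+1) @^-1` B' i)) => i.
  by apply: sigma_of_process_increment; rewrite ?mesh_ge0//; exact: mpre.
rewrite Pb muleC; congr (_ * (_ * _))%E.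
- rewrite (bm_indep bW1 n (t := mesh) (B := A') (mesh_ge0 _)
    mesh_homo (fun i => mpre _ _ _ (mA i))).
  by apply: eq_bigr => i _; exact: brownian_increment_affine.
- rewrite (bm_indep bW2 n (t := mesh) (B := B') (mesh_ge0 _)
    mesh_homo (fun i => mpre _ _ _ (mB i))).
  by apply: eq_bigr => i _; exact: brownian_increment_affine.
Qed.

Definition crowded_mesh : set T :=
  \bigcup_(i < n) dN i @^-1` (~` [set 0; 1]).

Lemma measurable_crowded_mesh : measurable crowded_mesh.
Proof.
apply: bigcup_measurable => i _; rewrite -[X in measurable X]setTI.
apply: measurable_increment => //; apply: measurableC; exact: measurableU.
Qed.

Lemma crowded_mesh_probability : (P crowded_mesh <= ((s * t) ^+ 2 / n%:R)%:E)%E.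
Proof.
have lam0 : 0 < s * h by rewrite mulr_gt0// mesh_step.
have le1 i : (P (dN i @^-1` (~` [set 0%R; 1%R])) <= ((s * h) ^+ 2)%:E)%E.
  have mp (x : R) : measurable (dN i @^-1` [set x]).
    by rewrite -[X in measurable X]setTI; apply: measurable_increment.
  have law k : P (dN i @^-1` [set k%:R]) = (poisson_pmf (s * h) k)%:E.
    by rewrite (pp_law NP (mesh_ge0 i) (mesh_ltS i)) mesh_subS.
  rewrite -preimage_setC probability_setC; last first.
    by rewrite preimage_setU; exact: measurableU.
  have -> : P (dN i @^-1` [set 0; 1]) =
      (poisson_pmf (s * h) 0 + poisson_pmf (s * h) 1)%:E.
    rewrite preimage_setU measureU//; last first.
      by apply/seteqP; split => // w [/= -> /eqP]; rewrite eq_sym oner_eq0.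
    by rewrite EFinD; congr (_ + _)%E; [exact: (law 0%N)|exact: (law 1%N)].
  rewrite -EFinB lee_fin.
  exact: poisson_pmf_small.
rewrite /crowded_mesh bigcup_mkord.
apply: (@le_trans _ _ (\sum_(i < n) P (dN i @^-1` (~` [set 0%R; 1%R])))%E).
  apply: (@Boole_inequality _ _ _ P (fun i => dN i @^-1` (~` [set 0; 1])) n) => i _.
  rewrite -[X in measurable X]setTI.
  apply: measurable_increment => //; apply: measurableC; exact: measurableU.
apply: (@le_trans _ _ (\sum_(i < n) ((s * h) ^+ 2)%:E)%E).
  by apply: lee_sum => i _.
rewrite sumEFin sumr_const card_ord lee_fin -mulr_natl.
rewrite le_eqVlt; apply/orP; left; apply/eqP; field.
by rewrite pnatr_eq0 -lt0n.
Qed.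

End mesh_laws.

(** * The limit density *)

(** With probability 1 - exp (- lam) of a jump in each step, r is the mean sign of one
    step. These bounds turn the estimates in r into estimates in the swap rate that
    are uniform in the mesh. *)
Lemma jump_rate_bounds (R : realType) (lam : R) (n : nat) : 0 < lam -> lam <= 2^-1 ->
  let r := 1 - 2 * (1 - expR (- lam)) in
  [/\ 0 <= r, r < 1, lam <= 1 - r & r ^+ n <= (1 + n%:R * lam)^-1].
Proof.
move=> lam0 lam2 r.
have E1 := expR_ge1Dx (- lam).
have pos : 0 < 1 + lam by rewrite addr_gt0.
have E2 : expR (- lam) <= (1 + lam)^-1.
  by rewrite expRN lef_pV2 ?posrE ?expR_gt0//; exact: expR_ge1Dx.
have inv : (1 + lam)^-1 <= 1 - lam / 2.
  rewrite -div1r ler_pdivrMr//.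
  have -> : (1 - lam / 2) * (1 + lam) = 1 + lam / 2 * (1 - lam) by field.
  by rewrite lerDl mulr_ge0// ?divr_ge0// ?ltW//; lra.
have r0 : 0 <= r by rewrite /r; lra.
have rle : r <= 1 - lam by rewrite /r; lra.
split => //; [by lra|by lra|].
have rE : r <= expR (- lam) by exact: le_trans rle E1.
apply: (@le_trans _ _ (expR (- lam) ^+ n)); first by rewrite lerXn2r// nnegrE expR_ge0.
rewrite -expRM_natl mulrN expRN lef_pV2 ?posrE ?expR_gt0//.
  exact: expR_ge1Dx.
by rewrite ltr_pwDl// mulr_ge0// ltW.
Qed.

Section open_limits.
Context (R : realType) d (T : measurableType d) (P : probability T R).

(** If the limit lies in an open set, then so do all but finitely many terms of the
    sequence. *)
Lemma open_liminf (Zk : nat -> T -> R * R) (Z : T -> R * R) (O : set (R * R)) (B : \bar R) :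
  (forall k, measurable_fun setT (Zk k)) -> measurable_fun setT Z ->
  {ae P, forall w, Zk k w @[k --> \oo] --> Z w} ->
  open O -> measurable O ->
  (\forall k \near \oo, (P (Zk k @^-1` O) <= B)%E) -> (P (Z @^-1` O) <= B)%E.
Proof.
move=> mZk mZ cv oO mO [k0 _ le].
have mpre (F : T -> R * R) : measurable_fun setT F -> measurable (F @^-1` O).
  by move=> mF; rewrite -[X in measurable X]setTI; exact: mF.
pose E j := \bigcap_(k in [set k | (maxn j k0 <= k)%N]) (Zk k @^-1` O).
have mE j : measurable (E j) by apply: bigcap_measurableType => k _; exact: mpre.
have EB j : (P (E j) <= B)%E.
  apply: le_trans (le (maxn j k0) _); last exact: leq_maxr.
  apply: le_measure; rewrite ?inE//; first exact: mpre.
  by move=> w; apply => /=.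
have ndE : nondecreasing_seq E.
  move=> i j ij; apply/subsetPset => w Ew k /= jk; apply: Ew => /=.
  by rewrite (leq_trans _ jk)// geq_max leq_maxr (leq_trans ij) ?leq_maxl.
have mUE : measurable (\bigcup_j E j) by exact: bigcupT_measurable.
have cvE := nondecreasing_cvg_mu (mu := P) mE mUE ndE.
have UB : (P (\bigcup_j E j) <= B)%E.
  rewrite -(cvg_lim _ cvE)//; apply: lime_le; first by apply/cvg_ex; eexists; exact: cvE.
  exact: nearW.
have [N0 [mN N00 sub]] := cv.
apply: le_trans UB.
apply: (@le_trans _ _ (P (\bigcup_j E j `|` N0))).
  apply: le_measure; rewrite ?inE//; [exact: mpre|exact: measurableU|].
  move=> w Ow; have [wc|wc] := pselect (Zk k w @[k --> \oo] --> Z w); last first.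
    by right; apply: sub.
  left; have /wc[j _ Hj] : nbhs (Z w) O by exact: open_nbhs_nbhs.
  by exists j => // k /=; rewrite geq_max => /andP[jk _]; exact: Hj.
have := measureU0 mUE mN N00; move=> ->//.
Qed.

End open_limits.

Section limit_density.
Context (R : realType).
Notation lambda2 := (@lebesgue_measure R \x @lebesgue_measure R)%E.

(** With no time difference left between the two states, the particles are independent
    normal variables centred at a and - a; both orders are equally likely. *)
Definition mixed_pdf (a : R) (z : R * R) : R :=
  (product_normal_pdf a 1 (- a) 1 z + product_normal_pdf (- a) 1 a 1 z) / 2.

Lemma mixed_pdf_ge0 a z : 0 <= mixed_pdf a z.
Proof. by rewrite divr_ge0// addr_ge0// product_normal_pdf_ge0. Qed.

Lemma measurable_mixed_pdf a : measurable_fun setT (mixed_pdf a).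
Proof.
by apply: measurable_funM => //; apply: measurable_funD;
  exact: measurable_product_normal_pdf.
Qed.

Lemma leaning_pdf0 (a be ka : R) :
  leaning_pdf a be ka 1 0 = product_normal_pdf a 1 (- a) 1 /\
  leaning_pdf a be ka (-1) 0 = product_normal_pdf (- a) 1 a 1.
Proof.
by rewrite /leaning_pdf !mulr0 !addr0 !subr0 sqrtr1 mul1r mulN1r opprK.
Qed.

Lemma integral_mixed_pdf_half a (B : set (R * R)) (x1 x2 : R) : measurable B ->
  (\int[lambda2]_(z in B) (product_normal_pdf a 1 (- a) 1 z)%:E = x1%:E)%E ->
  (\int[lambda2]_(z in B) (product_normal_pdf (- a) 1 a 1 z)%:E = x2%:E)%E ->
  (\int[lambda2]_(z in B) (mixed_pdf a z)%:E = ((x1 + x2) / 2)%:E)%E.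
Proof.
move=> mB I1 I2.
have mf m s m' s' : measurable_fun B (EFin \o (product_normal_pdf m s m' s' : R * R -> R)).
  by apply/measurable_EFinP; exact: measurable_funS (measurable_product_normal_pdf _ _ _ _).
have pdf0 m s m' s' (z : R * R) : B z -> (0 <= (EFin \o product_normal_pdf m s m' s') z)%E.
  by move=> _; rewrite lee_fin product_normal_pdf_ge0.
transitivity ((2^-1)%:E * (\int[lambda2]_(z in B)
      (EFin \o product_normal_pdf a 1 (- a) 1) z +
    \int[lambda2]_(z in B) (EFin \o product_normal_pdf (- a) 1 a 1) z))%E; last first.
  by rewrite I1 I2 -EFinD -EFinM mulrC.
rewrite -ge0_integralD//; last 4 first.
- exact: pdf0.
- exact: mf.
- exact: pdf0.
- exact: mf.
rewrite -ge0_integralZl//; last 2 first.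
- by apply: emeasurable_funD; exact: mf.
- by move=> z Bz; apply: adde_ge0; exact: pdf0.
by apply: eq_integral => z _; rewrite -EFinD -EFinM /mixed_pdf mulrC.
Qed.

Lemma integral_mixed_pdf a be ka (B : set (R * R)) : measurable B ->
  (\int[lambda2]_(z in B) (mixed_pdf a z)%:E =
   ((fine (leaning_normal a be ka 1 0 B) +
     fine (leaning_normal a be ka (-1) 0 B)) / 2)%:E)%E.
Proof.
move=> mB; have [f1 f2] := leaning_pdf0 a be ka.
have lt e : `|e * (ka * 0)| < 1 by rewrite !mulr0 normr0.
have [E1 _] := leaning_normal_fine a be ka 1 0 mB.
have [E2 _] := leaning_normal_fine a be ka (-1) 0 mB.
have I1 := etrans (esym (leaning_normal_density a be (lt 1) mB)) E1.
have I2 := etrans (esym (leaning_normal_density a be (lt (-1)) mB)) E2.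
rewrite f1 in I1; rewrite f2 in I2.
exact: integral_mixed_pdf_half mB I1 I2.
Qed.

Lemma integralT_mixed_pdf a : (\int[lambda2]_z (mixed_pdf a z)%:E = 1)%E.
Proof.
rewrite (integral_mixed_pdf a 0 0 measurableT).
have L1 e : leaning_normal a 0 0 e 0 setT = 1%E.
  exact: (probability_setT (affine_normal (e * (a + 0 * 0)) (Num.sqrt (1 + e * (0 * 0))) \x
   affine_normal (- (e * (a + 0 * 0))) (Num.sqrt (1 - e * (0 * 0))))%E).
by rewrite !L1/=; congr (_%:E); field.
Qed.

Lemma planar_normal_pdfE (z : R * R) :
  planar_normal_pdf z = product_normal_pdf 0 1 0 1 z.
Proof.
rewrite /planar_normal_pdf /product_normal_pdf !normal_pdfE ?oner_eq0//.
rewrite /normal_peak /normal_fun mulrACA -expRD; congr (_ * expR _).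
  rewrite expr1n mul1r -invfM -expr2 sqr_sqrtr; last exact: mulrn_wge0 (pi_ge0 R).
  by rewrite mulr_natl.
by rewrite ?expr1n !subr0; field.
Qed.

Lemma cvg_mixed_pdf (a_ : nat -> R) : a_ n @[n --> \oo] --> (0 : R) ->
  (\int[lambda2]_z (`|mixed_pdf (a_ n) z - planar_normal_pdf z|)%:E
    @[n --> \oo] --> 0)%E.
Proof.
move=> a0; rewrite (funext planar_normal_pdfE : @planar_normal_pdf R = _).
have aN : - a_ n @[n --> \oo] --> (0 : R) by rewrite -oppr0; exact: cvgN.
apply: scheffe.
- by move=> n; exact: measurable_mixed_pdf.
- exact: measurable_product_normal_pdf.
- by move=> n z; exact: mixed_pdf_ge0.
- by move=> z; exact: product_normal_pdf_ge0.
- by move=> n; exact: integralT_mixed_pdf.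
- exact: integral_product_normal_pdf.
- move=> z.
  have n1 : (1 : R) != 0 by exact: oner_neq0.
  have c1 : (fun=> 1 : R) n @[n --> \oo] --> (1 : R) by exact: cvg_cst.
  have -> : product_normal_pdf 0 1 0 1 z =
    (product_normal_pdf 0 1 0 1 z + product_normal_pdf 0 1 0 1 z) / 2 :> R by field.
  apply: cvgM; last exact: cvg_cst.
  apply: cvgD.
    exact: (@cvg_product_normal_pdf R a_ (fun=> 1) (fun n => - a_ n) (fun=> 1)).
  exact: (@cvg_product_normal_pdf R (fun n => - a_ n) (fun=> 1) a_ (fun=> 1)).
Qed.

End limit_density.

(** * The law of the scaled process *)

Section swapping_law.
Context (R : realType) d (T : measurableType d) (P : probability T R).
Variables (mu1 mu2 sigma1 sigma2 s x0 y0 t : R).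
Variables (X Y W1 W2 N : R -> {RV P >-> R}).
Hypotheses (sigma1_gt0 : 0 < sigma1) (sigma2_gt0 : 0 < sigma2).
Hypotheses (s0 : 0 < s) (t0 : 0 < t).
Hypothesis bsp : brownian_swapping_process mu1 mu2 sigma1 sigma2 s x0 y0 X Y W1 W2 N.

Let c : R := Num.sqrt ((sigma1 ^+ 2 + sigma2 ^+ 2) * t / 2).
Let m : R := (x0 + y0) / 2 + (mu1 + mu2) / 2 * t.
Let a : R := (x0 - y0) / (2 * c).
Let be : R := (mu1 - mu2) / (2 * c).
Let ka : R := (sigma1 ^+ 2 - sigma2 ^+ 2) / (2 * c ^+ 2).

Let S2 : 0 < sigma1 ^+ 2 + sigma2 ^+ 2.
Proof. by rewrite addr_gt0// exprn_gt0. Qed.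

Let c0 : 0 < c.
Proof. by rewrite sqrtr_gt0 divr_gt0// mulr_gt0. Qed.

Let c2 : c ^+ 2 = (sigma1 ^+ 2 + sigma2 ^+ 2) * t / 2.
Proof. by rewrite sqr_sqrtr// ltW// divr_gt0// mulr_gt0. Qed.

Section one_mesh.
Variable n : nat.
Hypothesis n0 : (0 < n)%N.
Local Notation h := (t / n%:R).

Let nR : n%:R != 0 :> R. Proof. by rewrite pnatr_eq0 -lt0n. Qed.

Let G1 i w := mu1 * h / c + sigma1 / c * increment W1 (mesh t n i) (mesh t n i.+1) w.
Let G2 i w := mu2 * h / c + sigma2 / c * increment W2 (mesh t n i) (mesh t n i.+1) w.

Definition scaled_mesh_position : T -> R * R :=
  discretized_position n (jump_event t n N) G1 G2 ((x0 - m) / c) ((y0 - m) / c).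

Let mG1 i : measurable_fun setT (G1 i).
Proof.
apply: measurable_funD => //; apply: measurable_funM => //.
exact: measurable_increment.
Qed.

Let mG2 i : measurable_fun setT (G2 i).
Proof.
apply: measurable_funD => //; apply: measurable_funM => //.
exact: measurable_increment.
Qed.

Lemma measurable_scaled_mesh_position : measurable_fun setT scaled_mesh_position.
Proof.
by apply: measurable_discretized_position => // i; exact: measurable_jump_event.
Qed.

Lemma scaled_mesh_position_law (O : set (R * R)) : measurable O ->
  P (scaled_mesh_position @^-1` O) =
  (\sum_(b : {ffun 'I_n -> bool}) (jump_weight (jump_probability t s n) b)%:E *
     leaning_normal a be ka (jump_sign R b n)
       (h * \sum_(i < n) jump_sign R b i) O)%E.
Proof.
move=> mO.
have cn0 : c != 0 by rewrite gt_eqF.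
have h0 : 0 < h := mesh_step t0 n0.
have sh2 : Num.sqrt h ^+ 2 = h by rewrite sqr_sqrtr// ltW.
have p01 := jump_probability01 t0 s0 n0.
have sq x : (x / c * Num.sqrt h) ^+ 2 = x ^+ 2 * h / c ^+ 2.
  by rewrite exprMn sh2 expr_div_n mulrAC.
rewrite /scaled_mesh_position.
apply: (@discretized_law d T R P n (jump_event t n N) G1 G2 (jump_probability t s n)
  (mu1 * h / c) (sigma1 / c * Num.sqrt h) (mu2 * h / c) (sigma2 / c * Num.sqrt h)
  ((x0 - m) / c) ((y0 - m) / c) _ mG1 mG2 _ _ p01 _ a be ka h _ _ _ _ _ O mO).
- exact: measurable_jump_event.
- by rewrite mulr_ge0// ?divr_ge0 ?sqrtr_ge0// ltW.
- by rewrite mulr_ge0// ?divr_ge0 ?sqrtr_ge0// ltW.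
- move=> b A B mA mB.
  exact: (mesh_product_rule t0 s0 n0 (bsp_N bsp) _ _ _ _
    (bsp_W1 bsp) (bsp_W2 bsp) (bsp_indep bsp)).
- rewrite /a /m; field; rewrite nR cn0//.
- rewrite /a /m; field; rewrite nR cn0//.
- rewrite /be; field; rewrite nR cn0//.
- rewrite !sq c2; field.
  by rewrite nR (gt_eqF t0) (gt_eqF S2).
- rewrite !sq /ka; field; rewrite nR cn0//.
Qed.

(** The bound does not involve n, and its error terms vanish as s grows. *)
Lemma scaled_mesh_position_bound (O : set (R * R)) (eps C : R) : measurable O ->
  s * h <= 2^-1 -> 0 <= C ->
  (forall e A, e ^+ 2 = 1 ->
     fine (leaning_normal a be ka e A O) <=
     fine (leaning_normal a be ka e 0 O) + eps + C * A ^+ 2) ->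
  (P (scaled_mesh_position @^-1` O) <=
   ((fine (leaning_normal a be ka 1 0 O) + fine (leaning_normal a be ka (-1) 0 O)) / 2 +
     (eps + C * (2 * t / s) + (1 + s * t)^-1))%:E)%E.
Proof.
move=> mO sh C0 HC; rewrite scaled_mesh_position_law//.
have h0 : 0 < h := mesh_step t0 n0.
have p01 := jump_probability01 t0 s0 n0.
pose p := jump_probability t s n.
pose L e A := fine (leaning_normal a be ka e A O).
have L01 e A : 0 <= L e A <= 1 by have [] := leaning_normal_fine a be ka e A mO.
have LE e A : leaning_normal a be ka e A O = (L e A)%:E.
  by have [] := leaning_normal_fine a be ka e A mO.
have [r0 r1 r2 r3] := jump_rate_bounds n (mulr_gt0 s0 h0) sh.
rewrite -[1 - _ * _]/(1 - 2 * p) in r0 r1 r2 r3.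
have HC' e A : e ^+ 2 = 1 -> `|A| <= n%:R * h -> L e A <= L e 0 + eps + C * A ^+ 2.
  by move=> e1 _; exact: HC.
have := jump_average_bound p01 r0 r1 (ltW h0) C0 L01 HC'.
rewrite (eq_bigr (fun b : {ffun 'I_n -> bool} => (jump_weight p b *
  L (jump_sign R b n) (h * \sum_(i < n) jump_sign R b i))%:E)); last first.
  by move=> b _; rewrite EFinM -LE.
rewrite sumEFin lee_fin => /le_trans; apply.
rewrite -!addrA lerD2l lerD2l lerD//.
  apply: ler_wpM2l => //.
  apply: (@le_trans _ _ (h ^+ 2 * (n%:R * (2 / (s * h))))).
    rewrite ler_wpM2l ?sqr_ge0// ler_wpM2l// ler_wpM2l//.
    rewrite lef_pV2 ?posrE ?mulr_gt0 ?invr_gt0 ?ltr0n//.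
    by rewrite subr_gt0.
  rewrite le_eqVlt; apply/orP; left; apply/eqP; field.
  by rewrite nR (gt_eqF s0) (gt_eqF t0).
apply: le_trans r3 _; rewrite le_eqVlt; apply/orP; left; apply/eqP; congr (_^-1).
by field.
Qed.

End one_mesh.

Let dyadic k : (0 < 2 ^ k)%N. Proof. by rewrite expn_gt0. Qed.

(** Borel-Cantelli: halving the mesh halves the bound on the probability of a crowded
    interval. *)
Lemma eventually_uncrowded : {ae P, forall w, \forall k \near \oo,
  ~ crowded_mesh t (2 ^ k) N w}.
Proof.
have mF k : measurable (crowded_mesh t (2 ^ k) N) by exact: measurable_crowded_mesh.
have sumF : (\sum_(k <oo) P (crowded_mesh t (2 ^ k) N) < +oo)%E.
  (* The factor 2 fits the terms e / 2^(k+1) of the geometric series. *)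
  pose e : R := 2 * (s * t) ^+ 2.
  have e0 : 0 <= e by rewrite mulr_ge0// sqr_ge0.
  apply: (@le_lt_trans _ _ (\sum_(k <oo) (0 + (e / (2 ^ k.+1)%:R)%:E))%E).
    apply: lee_nneseries => [k _ _|k _]; first exact: measure_ge0.
    rewrite add0e.
    apply: le_trans (crowded_mesh_probability t0 s0 (dyadic k) (bsp_N bsp)) _.
    rewrite lee_fin /e expnS natrM le_eqVlt; apply/orP; left; apply/eqP.
    by field; rewrite pnatr_eq0 -lt0n.
  apply: le_lt_trans (@epsilon_trick R (fun=> 0%E) e xpredT (fun=> lexx _) e0) _.
  by rewrite eseries0// add0e ltry.
have null := lim_sup_set_cvg0 mF sumF.
exists (lim_sup_set (fun k => crowded_mesh t (2 ^ k) N)); split => //.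
  apply: bigcapT_measurable => n; apply: bigcup_measurable => k _; exact: mF.
move=> w nw n _; apply: contrapT => H; apply: nw.
exists n => // k /= nk Fk; apply: H; by exists k.
Qed.

Let dyadic_inv_cvg : (2 ^ k)%:R^-1 @[k --> \oo] --> (0 : R).
Proof.
under eq_cvg => k do rewrite natrX -exprVn.
by apply: cvg_expr; rewrite ger0_norm ?invr_ge0// invf_lt1// ltr1n.
Qed.

Definition scaled_position (w : T) : R * R :=
  diffusive_scaling mu1 mu2 sigma1 sigma2 x0 y0 t (X t w, Y t w).

Lemma scaled_mesh_positionE (n : nat) w : (0 < n)%N ->
  let da i := mu1 * mesh t n i.+1 + sigma1 * W1 (mesh t n i.+1) w -
              (mu1 * mesh t n i + sigma1 * W1 (mesh t n i) w) in
  let db i := mu2 * mesh t n i.+1 + sigma2 * W2 (mesh t n i.+1) w -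
              (mu2 * mesh t n i + sigma2 * W2 (mesh t n i) w) in
  let cw := even_jumps (fun i => N (mesh t n i.+1) w != N (mesh t n i) w) in
  scaled_mesh_position n w = diffusive_scaling mu1 mu2 sigma1 sigma2 x0 y0 t
   (let U := x0 + select_sum cw da db n in
    let V := y0 + select_sum (negb \o cw) da db n in
    if cw n then (U, V) else (V, U)).
Proof.
move=> n0 da db cw; rewrite /scaled_mesh_position /discretized_position.
have -> : (fun j => `[< jump_event t n N j w >]) =
    (fun i => N (mesh t n i.+1) w != N (mesh t n i) w).
  apply/funext => j; rewrite -subr_eq0; apply/asboolP/idP => [H|/eqP //].
  by apply/eqP.
rewrite -/cw /tracked_position.
have sumE c' (z0 : R) :
    (z0 - m) / c + select_sum c'
      (fun i => mu1 * (t / n%:R) / c +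
        sigma1 / c * increment W1 (mesh t n i) (mesh t n i.+1) w)
      (fun i => mu2 * (t / n%:R) / c +
        sigma2 / c * increment W2 (mesh t n i) (mesh t n i.+1) w) n =
    (z0 + select_sum c' da db n - m) / c.
  have -> : z0 + select_sum c' da db n - m = (z0 - m) + select_sum c' da db n by ring.
  rewrite [RHS]mulrDl; congr (_ + _); rewrite /select_sum mulr_suml.
  apply: eq_bigr => i _; rewrite -(mesh_subS t n i) /increment /da /db.
  by case: (c' i); ring.
rewrite /diffusive_scaling -/m -/c.
by case: (cw n); rewrite /= !sumE.
Qed.

Lemma scaled_mesh_position_cvg :
  {ae P, forall w, scaled_mesh_position (2 ^ k) w @[k --> \oo] --> scaled_position w}.
Proof.
have unc := eventually_uncrowded.
have [i1 _ _ cW1] := bsp_W1 bsp; have [i2 _ _ cW2] := bsp_W2 bsp.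
have [iN _ _ cN mN rN] := bsp_N bsp.
have eX := bsp_X bsp; have eY := bsp_Y bsp.
near=> w.
have uncw : \forall k \near \oo, ~ crowded_mesh t (2 ^ k) N w by near: w.
have i1w : W1 0 w = 0 by near: w.
have i2w : W2 0 w = 0 by near: w.
have iNw : N 0 w = 0 by near: w.
have c1w : {within `[0, +oo[%classic, continuous (fun u : R => W1 u w)} by near: w.
have c2w : {within `[0, +oo[%classic, continuous (fun u : R => W2 u w)} by near: w.
have cNw : forall u : R, 0 <= u -> exists k : nat, N u w = k%:R by near: w.
have mNw : forall u v : R, 0 <= u -> u <= v -> N u w <= N v w by near: w.
have rNw : cadlag (fun u : R => N u w) by near: w.
have eXw : forall u : R, 0 <= u -> X u w = x0 + mu1 * u + sigma1 * W1 u w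
            + jump_integral (fun u => Y u w - X u w) (fun u => N u w) u by near: w.
have eYw : forall u : R, 0 <= u -> Y u w = y0 + mu2 * u + sigma2 * W2 u w
            + jump_integral (fun u => X u w - Y u w) (fun u => N u w) u by near: w.
have cont mu sigma (W : R -> R) : {within `[0, +oo[%classic, continuous W} ->
    {within `[0, +oo[%classic, continuous (fun u : R => mu * u + sigma * W u)}.
  have cid : {within `[0, +oo[%classic, continuous (fun u : R => u)}.
    by apply: continuous_subspaceT => x; exact: cvg_id.
  move=> cW u; apply: cvgD; apply: cvgM; [exact: cvg_cst| |exact: cvg_cst|exact: cW].
  exact: cid.
have := @mesh_cvg R (fun u => N u w) (fun u => mu1 * u + sigma1 * W1 u w)
  (fun u => mu2 * u + sigma2 * W2 u w) (fun u => X u w) (fun u => Y u w) x0 y0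
  cNw mNw (proj1 rNw) iNw (cont _ _ _ c1w) (cont _ _ _ c2w).
rewrite !mulr0 i1w i2w !mulr0 !addr0 => /(_ erefl erefl).
have eXw' u : 0 <= u -> X u w = x0 + (mu1 * u + sigma1 * W1 u w)
            + jump_integral (fun u => Y u w - X u w) (fun u => N u w) u.
  by move=> /eXw ->; rewrite !addrA.
have eYw' u : 0 <= u -> Y u w = y0 + (mu2 * u + sigma2 * W2 u w)
            + jump_integral (fun u => X u w - Y u w) (fun u => N u w) u.
  by move=> /eYw ->; rewrite !addrA.
move=> /(_ eXw' eYw' t (fun k => (2 ^ k)%N) t0 dyadic dyadic_inv_cvg) lim.
have sparse : \forall k \near \oo, forall i, (i < 2 ^ k)%N ->
    N (mesh t (2 ^ k) i.+1) w = N (mesh t (2 ^ k) i) w \/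
    N (mesh t (2 ^ k) i.+1) w = N (mesh t (2 ^ k) i) w + 1.
  apply: filterS uncw => k nc i ik; apply: contrapT => /not_orP[n0 n1].
  apply: nc; exists i => //= -[|]; rewrite /increment => /eqP.
    by rewrite subr_eq0 => /eqP.
  by rewrite subr_eq addrC => /eqP.
have {}lim := lim sparse.
pose sc := diffusive_scaling mu1 mu2 sigma1 sigma2 x0 y0 t.
have csc (F : nat -> R * R) (z : R * R) : F k @[k --> \oo] --> z ->
    sc (F k) @[k --> \oo] --> sc z.
  move=> Fz.
  have F1 : (F k).1 @[k --> \oo] --> z.1 by apply: cvg_comp Fz _; exact: cvg_fst.
  have F2 : (F k).2 @[k --> \oo] --> z.2 by apply: cvg_comp Fz _; exact: cvg_snd.
  have cs1 : ((F k).1 - m) / c @[k --> \oo] --> (z.1 - m) / c.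
    by apply: cvgM; [apply: cvgB => //|]; exact: cvg_cst.
  have cs2 : ((F k).2 - m) / c @[k --> \oo] --> (z.2 - m) / c.
    by apply: cvgM; [apply: cvgB => //|]; exact: cvg_cst.
  exact: (cvg_pair cs1 cs2).
have := csc _ _ lim; rewrite -/(scaled_position w).
apply: cvg_trans; apply: near_eq_cvg; apply: nearW => k.
by rewrite (scaled_mesh_positionE w (dyadic k)).
Unshelve. all: by end_near. Qed.

Lemma measurable_scaled_position : measurable_fun setT scaled_position.
Proof.
by apply/measurable_fun_pairP; split; apply: measurable_funM => //;
  apply: measurable_funB.
Qed.

(** The uniform bound on the discretized laws passes to the limit on open sets. *)
Lemma scaled_position_bound (eps C : R) : 0 <= C ->
  (forall (O : set (R * R)) e A, measurable O -> e ^+ 2 = 1 ->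
     fine (leaning_normal a be ka e A O) <=
     fine (leaning_normal a be ka e 0 O) + eps + C * A ^+ 2) ->
  forall (O : set (R * R)), open O -> measurable O ->
  (P (scaled_position @^-1` O) <=
   \int[lebesgue_measure \x lebesgue_measure]_(z in O) (mixed_pdf a z)%:E +
     (eps + C * (2 * t / s) + (1 + s * t)^-1)%:E)%E.
Proof.
move=> C0 HC O oO mO; rewrite (integral_mixed_pdf a be ka mO) -EFinD.
apply: (open_liminf (Zk := fun k => scaled_mesh_position (2 ^ k)) _ _ _ oO mO).
- by move=> k; exact: measurable_scaled_mesh_position.
- exact: measurable_scaled_position.
- exact: scaled_mesh_position_cvg.
have : s * t * (2 ^ k)%:R^-1 @[k --> \oo] --> (0 : R).
  by rewrite -(mulr0 (s * t)); apply: cvgM => //; exact: cvg_cst.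
have half0 : 0 < 2^-1 :> R by rewrite invr_gt0.
move/cvgr0Pnorm_le => /(_ _ half0); apply: filterS => k small.
apply: (scaled_mesh_position_bound (dyadic k) mO _ C0).
  by rewrite mulrA (le_trans (ler_norm _)).
by move=> e A; exact: HC.
Qed.

(** Outer regularity of the limit law extends the bound from open sets to Borel sets,
    at the cost of another eps. *)
Lemma scaled_position_law (eps C : R) : 0 < eps -> 0 <= C ->
  (forall (O : set (R * R)) e A, measurable O -> e ^+ 2 = 1 ->
     fine (leaning_normal a be ka e A O) <=
     fine (leaning_normal a be ka e 0 O) + eps + C * A ^+ 2) ->
  forall (B : set (R * R)), measurable B ->
  (P (scaled_position @^-1` B) <=
   \int[lebesgue_measure \x lebesgue_measure]_(z in B) (mixed_pdf a z)%:E +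
     (2 * eps + C * (2 * t / s) + (1 + s * t)^-1)%:E)%E.
Proof.
move=> eps0 C0 HC B mB.
pose nu0 : {measure set (measurableTypeR R * measurableTypeR R) -> \bar R} :=
  density_measure (lebesgue_measure \x lebesgue_measure)%E
    (measurable_mixed_pdf a) (mixed_pdf_ge0 a).
pose nu : {measure set (R * R) -> \bar R} := image_measure nu0 (@measurable_plane_id R).
have nuT : (nu setT < +oo)%E.
  by rewrite [nu _]integralT_mixed_pdf ltry.
have [U [oU mU BU le]] := outer_regular nuT mB eps0.
have mpre (D : set (R * R)) : measurable D -> measurable (scaled_position @^-1` D).
  by move=> mD; rewrite -[X in measurable X]setTI; exact: measurable_scaled_position.
apply: (@le_trans _ _ (P (scaled_position @^-1` U))).
  apply: le_measure; rewrite ?inE; [exact: mpre|exact: mpre|].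
  by move=> w /BU.
apply: le_trans (scaled_position_bound C0 HC oU mU) _.
apply: (@le_trans _ _ (nu B + eps%:E + (eps + C * (2 * t / s) + (1 + s * t)^-1)%:E)%E).
  exact: leeD2r.
rewrite -addeA -EFinD; apply: leeD2l; rewrite lee_fin.
by rewrite le_eqVlt; apply/orP; left; apply/eqP; ring.
Qed.

End swapping_law.

(** * Convergence of the densities *)

Lemma cvg_ereal0 (R : realType) (F : set_system R) (u : R -> \bar R) : Filter F ->
  (forall x, (0 <= u x)%E) ->
  (forall e : R, 0 < e -> \forall x \near F, (u x <= e%:E)%E) ->
  (u x @[x --> F] --> 0)%E.
Proof.
move=> FF u0 H; apply/fine_cvgP; split.
  apply: filterS (H 1 ltr01) => x ux; rewrite ge0_fin_numE//.
  exact: le_lt_trans ux (ltry _).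
apply/cvgr0Pnorm_le => e e0; apply: filterS (H e e0) => x ux.
rewrite /= ger0_norm ?fine_ge0// -lee_fin fineK//.
by rewrite ge0_fin_numE// (le_lt_trans ux (ltry _)).
Qed.

Lemma L1_dist_ge0 (R : realType) (f g : R * R -> R) : (0 <= L1_dist f g)%E.
Proof. by apply: integral_ge0 => z _; rewrite lee_fin. Qed.

Section scaled_density.
Context (R : realType) (mu1 mu2 sigma1 sigma2 x0 y0 : R).
Hypotheses (sigma1_gt0 : 0 < sigma1) (sigma2_gt0 : 0 < sigma2).

Definition spread (t : R) : R := Num.sqrt ((sigma1 ^+ 2 + sigma2 ^+ 2) * t / 2).

Definition half_gap (t : R) : R := (x0 - y0) / (2 * spread t).

Lemma half_gap_cvg : half_gap t @[t --> +oo] --> (0 : R).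
Proof.
have S2 : 0 < sigma1 ^+ 2 + sigma2 ^+ 2 by rewrite addr_gt0// exprn_gt0.
apply/cvgr0Pnorm_le => e e0.
(* The time at which the spread reaches |x0 - y0| / (2 e). *)
pose M := (`|x0 - y0| / (2 * e)) ^+ 2 / ((sigma1 ^+ 2 + sigma2 ^+ 2) / 2).
near=> t.
have t0 : 0 < t by near: t; exact: nbhs_pinfty_gt.
have tM : M <= t by near: t; apply: nbhs_pinfty_ge; exact: num_real.
have c0 : 0 < spread t by rewrite sqrtr_gt0 divr_gt0// mulr_gt0.
have le : `|x0 - y0| / (2 * e) <= spread t.
  have ge0 : 0 <= `|x0 - y0| / (2 * e) by rewrite divr_ge0// mulr_ge0// ltW.
  rewrite -[leLHS]ger0_norm// -sqrtr_sqr ler_wsqrtr//.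
  by move: tM; rewrite /M ler_pdivrMr ?divr_gt0// => /le_trans; apply; rewrite mulrC mulrAC.
rewrite /half_gap normrM normfV (gtr0_norm (mulr_gt0 _ c0))// ler_pdivrMr ?mulr_gt0//.
by move: le; rewrite ler_pdivrMr ?mulr_gt0// => /le_trans; apply; rewrite le_eqVlt;
  apply/orP; left; apply/eqP; ring.
Unshelve. all: by end_near. Qed.

Lemma scaled_density_bound s t (p : R -> R * R -> R) (f : R * R -> R) (eps C : R) :
  0 < s -> 0 < t -> 0 < eps -> 0 <= C ->
  (forall (O : set (R * R)) e A, measurable O -> e ^+ 2 = 1 ->
     fine (leaning_normal (half_gap t) ((mu1 - mu2) / (2 * spread t))
       ((sigma1 ^+ 2 - sigma2 ^+ 2) / (2 * spread t ^+ 2)) e A O) <=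
     fine (leaning_normal (half_gap t) ((mu1 - mu2) / (2 * spread t))
       ((sigma1 ^+ 2 - sigma2 ^+ 2) / (2 * spread t ^+ 2)) e 0 O) + eps + C * A ^+ 2) ->
  is_transition_density mu1 mu2 sigma1 sigma2 s x0 y0 p ->
  is_density (law_under (p t) (diffusive_scaling mu1 mu2 sigma1 sigma2 x0 y0 t)) f ->
  (L1_dist f (mixed_pdf (half_gap t)) <=
    (2 * (2 * eps + C * (2 * t / s) + (1 + s * t)^-1))%:E)%E.
Proof.
move=> s0 t0 eps0 C0 HC [d [T [P [X [Y [W1 [W2 [N [bsp pdens]]]]]]]]] [mf f0 fdens].
have [mp p0 pE] := pdens t t0.
have msc : measurable_fun setT (diffusive_scaling mu1 mu2 sigma1 sigma2 x0 y0 t).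
  apply/measurable_fun_pairP; split; apply: measurable_funM => //;
  by apply: measurable_funB.
have law B : measurable B -> (\int[lebesgue_measure \x lebesgue_measure]_(z in B) (f z)%:E =
    P (scaled_position mu1 mu2 sigma1 sigma2 x0 y0 t X Y @^-1` B))%E.
  move=> mB; rewrite -fdens// /law_under -pE//.
  by rewrite -[X in measurable X]setTI; exact: msc.
have f1 : (\int[lebesgue_measure \x lebesgue_measure]_z (f z)%:E = 1)%E.
  by rewrite law// preimage_setT probability_setT.
rewrite /L1_dist; apply: le_integral_dist => //.
- exact: measurable_mixed_pdf.
- exact: mixed_pdf_ge0.
- exact: integralT_mixed_pdf.
move=> B mB.
rewrite law//.
exact: (scaled_position_law sigma1_gt0 sigma2_gt0 s0 t0 bsp eps0 C0 HC mB).
Qed.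

End scaled_density.

Theorem proposition5p6 (R : realType) (mu1 mu2 sigma1 sigma2 x0 y0 : R)
    (p q : R -> R -> R * R -> R) :
  0 < sigma1 -> 0 < sigma2 ->
  (forall s, 0 < s ->
     is_transition_density mu1 mu2 sigma1 sigma2 s x0 y0 (p s)) ->
  (forall s t, 0 < s -> 0 < t ->
     is_density
       (law_under (p s t) (diffusive_scaling mu1 mu2 sigma1 sigma2 x0 y0 t))
       (q s t)) ->
  exists g : R -> R * R -> R,
    (forall t, 0 < t ->
       (lebesgue_measure \x lebesgue_measure)%E.-integrable setT
         (EFin \o g t) /\
       L1_dist (q s t) (g t) @[s --> +oo] --> 0%E) /\
    L1_dist (g t) (@planar_normal_pdf R) @[t --> +oo] --> 0%E.
Proof.
move=> sigma1_gt0 sigma2_gt0 pdens qdens.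
exists (fun t => mixed_pdf (half_gap sigma1 sigma2 x0 y0 t)); split; last first.
  apply/cvge_pinftyP => u uy.
  have := half_gap_cvg x0 y0 sigma1_gt0 sigma2_gt0.
  by move/cvg_pinftyP => /(_ _ uy) /cvg_mixed_pdf.
move=> t t0; split.
  apply: integrable_density; [exact: measurable_mixed_pdf|exact: mixed_pdf_ge0|].
  by rewrite integralT_mixed_pdf ltry.
apply: cvg_ereal0 => [s|e e0]; first exact: L1_dist_ge0.
have eps0 : 0 < e / 8 by rewrite divr_gt0.
have [C C0 HC] := leaning_normal_perturbation (half_gap sigma1 sigma2 x0 y0 t)
  ((mu1 - mu2) / (2 * spread sigma1 sigma2 t))
  ((sigma1 ^+ 2 - sigma2 ^+ 2) / (2 * spread sigma1 sigma2 t ^+ 2)) eps0.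
near=> s.
have s0 : 0 < s by near: s; exact: nbhs_pinfty_gt.
have sC : 16 * C * t / e <= s by near: s; apply: nbhs_pinfty_ge; exact: num_real.
have st : 8 / (e * t) <= s by near: s; apply: nbhs_pinfty_ge; exact: num_real.
apply: le_trans (scaled_density_bound sigma1_gt0 sigma2_gt0 s0 t0 eps0 C0 HC
  (pdens s s0) (qdens s t s0 t0)) _.
rewrite lee_fin.
have b1 : C * (2 * t / s) <= e / 8.
  rewrite mulrA ler_pdivrMr//; move: sC; rewrite ler_pdivrMr//; lra.
have b2 : (1 + s * t)^-1 <= e / 8.
  rewrite -[leRHS]invrK lef_pV2 ?posrE ?invr_gt0// ?addr_gt0 ?mulr_gt0//.
  move: st; rewrite invf_div ler_pdivrMr ?mulr_gt0// => H.
  by rewrite ler_pdivrMr//; lra.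
lra.
Unshelve. all: by end_near. Qed.
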